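(* There exists $\epsilon_0>0$ such that the following holds for every constant $0<\epsilon<\epsilon_0$. Let $d=d(n)$ satisfy $d=o(n)$, $d\ge 3$, and let $p=\frac{1+\epsilon}{d}$. Assume $2\sqrt{\frac{d}{n}}<\alpha<\epsilon^3$, and let $G=(V,E)$ be an $(n,d,\lambda)$-graph with $\lambda/d\le \alpha^{2/\alpha}$. Then there exists a constant $\beta=\beta(\epsilon)>0$ such that with probability at least $1-\exp\left(-\beta\frac{\alpha^2 n}{d}\right)$, $G[V_p]$ contains a cycle of length at least $\frac{\epsilon^2 n}{10^2 d}$.
   Context: An $(n,d,\lambda)$-graph is a $d$-regular graph on $n$ vertices whose adjacency eigenvalues $d=\lambda_1\ge\lambda_2\ge\dots\ge\lambda_n$ satisfy $\lambda=\max(|\lambda_2|,|\lambda_n|)$. $V_p$ is the random subset of $V$ obtained by including each vertex independently with probability $p$, and $G[V_p]$ is the induced subgraph. The parameter $\alpha$ may depend on $n$. *)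

(* Defs.v *)
From HB Require Import structures.
From mathcomp Require Import all_boot all_order all_algebra.
From mathcomp Require Import all_classical all_reals all_analysis.

Set Implicit Arguments.
Unset Strict Implicit.
Unset Printing Implicit Defensive.

Import Order.TTheory GRing.Theory Num.Theory.
Import numFieldNormedType.Exports.

Local Open Scope ring_scope.

Record sgraph := SGraph {
  vertex :> finType;
  adj : rel vertex;
  adj_sym : symmetric adj;
  adj_irrefl : irreflexive adj
}.

Definition regular_graph (G : sgraph) (d : nat) : Prop :=
  forall x : G, #|[pred y | adj x y]| = d.

Definition adjacency_matrix (R : realType) (G : sgraph) : 'M[R]_#|G| :=
  \matrix_(i, j) (adj (enum_val i) (enum_val j))%:R.

(* [ev] lists all eigenvalues of the adjacency matrix, with multiplicity,
   in nonincreasing order. *)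
Definition adjacency_spectrum (R : realType) (G : sgraph) (ev : seq R) : Prop :=
  sorted >=%R ev /\
  char_poly (adjacency_matrix R G) = \prod_(x <- ev) ('X - x%:P).

(* Eigenvalues are numbered from 0 here: lambda_1, lambda_2 and lambda_n are
   [ev`_0], [ev`_1] and [ev`_n.-1]. *)
Definition ndlambda_graph (R : realType) (n d : nat) (lambda : R)
    (G : sgraph) : Prop :=
  [/\ #|G| = n, regular_graph G d &
      exists ev : seq R,
        [/\ adjacency_spectrum G ev, ev`_0 = d%:R &
            lambda = Num.max `|ev`_1| `|ev`_n.-1|]].

Section Induced.
Variables (G : sgraph) (S : {set G}).

Definition induced_adj : rel {x : G | x \in S} :=
  fun x y => adj (val x) (val y).

Lemma induced_adj_sym : symmetric induced_adj.
Proof. by move=> x y; apply: adj_sym. Qed.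

Lemma induced_adj_irrefl : irreflexive induced_adj.
Proof. by move=> x; apply: adj_irrefl. Qed.

Definition induced_subgraph : sgraph := SGraph induced_adj_sym induced_adj_irrefl.
End Induced.

(* A graph cycle is a cyclic sequence of at least three distinct vertices:
   [ucycle] alone would also accept a single edge, as a sequence of size 2. *)
Definition has_cycle_ge (R : realType) (G : sgraph) (L : R) : Prop :=
  exists s : seq G,
    [/\ ucycle (@adj G) s, (3 <= size s)%N & L <= (size s)%:R].

(* Probability of the event [Q] for the random subset of [T] that contains each
   element independently with probability [p]. *)
Definition random_subset_prob (R : realType) (T : finType) (p : R)
    (Q : {set T} -> Prop) : R :=
  \sum_(S : {set T} | `[< Q S >]) \prod_(x : T) (if x \in S then p else 1 - p).

(* Main.v *)
Require Import Defs.
From HB Require Import structures.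
From mathcomp Require Import all_boot all_order all_algebra.
From mathcomp Require Import all_classical all_reals all_analysis.
From mathcomp Require Import complex spectral fintype finset.
From mathcomp Require Import zify ring lra.

Import Order.TTheory GRing.Theory Num.Theory.
Import numFieldNormedType.Exports.

Set Implicit Arguments.
Unset Strict Implicit.
Unset Printing Implicit Defensive.

Local Open Scope ring_scope.

(* Since [alpha `^ (2 / alpha)] increases with [alpha], the hypothesis forces [lambda / d]
   below a constant that is super-exponentially small in [eps].  The spectral gap then says
   that for every vertex set [Z] all but a tiny proportion of the vertices have about
   [d |Z| / n] neighbours in [Z].  Adding the elements of a set one by one, a union bound
   shows that with probability [1 - exp (- c n / d)] every subset [S] of the random set of
   a given size of order [n / d] has almost [d |S|] neighbours, and that the neighbourhoods
   of any two disjoint subsets intersect in linearly many vertices.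

   The random set is exposed in two rounds.  In the first one, of density
   [(1 + 9 eps / 10) / d], a depth-first search makes [eps n / 4] queries; about
   [(1 + 9 eps / 10) eps n / (4 d)] of them are open, and the fully explored open vertices
   have all their neighbours among the queried ones.  Expansion therefore forces the stack,
   which is a path, to have length at least three times [eps^2 n / (100 d)].  The first and
   last thirds of that path have linearly many common neighbours, and the second round
   opens one of them, which closes a long cycle. *)

(** * Spectral discrepancy *)

Section Spectral.
Local Open Scope sesquilinear_scope.

Lemma dot_unitary (C : numClosedFieldType) n (P : 'M[C]_n) (u v : 'rV[C]_n) :
  P \is unitarymx -> (u *m P^t*) *m (v *m P^t*)^t* = u *m v^t*.
Proof.
move=> Pu; rewrite trmx_mul map_mxM /= trmxCK mulmxA.
by rewrite -invmx_unitary // mulmxKV // unitarymx_unit.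
Qed.

Lemma dot_selfE (C : numClosedFieldType) n (u : 'rV[C]_n) :
  (u *m u^t*) 0 0 = \sum_j `|u 0 j| ^+ 2.
Proof. by rewrite mxE; apply: eq_bigr => j _; rewrite !mxE normCK. Qed.

Lemma char_poly_unitary_diag (C : numClosedFieldType) n (A P : 'M[C]_n)
    (D : 'rV[C]_n) :
  P \is unitarymx -> A = invmx P *m diag_mx D *m P ->
  char_poly A = \prod_(i < n) ('X - (D 0 i)%:P).
Proof.
move=> /unitarymx_unit Pu ->.
have -> : \prod_(i < n) ('X - (D 0 i)%:P) = char_poly (diag_mx D).
  rewrite char_poly_trig ?diag_mx_is_trig //.
  by apply: eq_bigr => i _; rewrite mxE eqxx.
have PpV : map_mx polyC (invmx P) *m map_mx polyC P = 1%:M.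
  by rewrite -map_mxM mulVmx // map_mx1.
rewrite /char_poly; suff -> : char_poly_mx (invmx P *m diag_mx D *m P) =
    map_mx polyC (invmx P) *m char_poly_mx (diag_mx D) *m map_mx polyC P.
  by rewrite !det_mulmx mulrAC -det_mulmx PpV det1 mul1r.
rewrite /char_poly_mx mulmxBr mulmxBl !map_mxM; congr (_ - _).
by rewrite scalar_mxC -mulmxA PpV mulmx1.
Qed.

(** The complexification of [A] is hermitian, so a unitary [P] diagonalises it. Since [lambda < a],
    the value [a] occurs once on the diagonal, and [e] lives on that coordinate alone. A vector
    orthogonal to [e] vanishes there, and its other coordinates are scaled by at most [lambda]. *)
Lemma contraction_off_eigenvector (R : rcfType) n (A : 'M[R]_n) (ev : seq R)
    (a lambda : R) (e x : 'rV[R]_n) :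
  A^T = A -> char_poly A = \prod_(z <- a :: ev) ('X - z%:P) ->
  (forall z, z \in ev -> `|z| <= lambda) -> lambda < a ->
  e *m A = a *: e -> e != 0 -> x *m e^T = 0 ->
  \sum_j (x *m A) 0 j ^+ 2 <= lambda ^+ 2 * \sum_j x 0 j ^+ 2.
Proof.
move=> Asym chA evle la eA e0 xe.
pose f : {rmorphism R -> R[i]} := real_complex R.
pose AC := map_mx f A; pose P := spectralmx AC; pose D := spectral_diag AC.
have conjfE (u : R) : (f u)^* = f u by exact: conjc_real.
have normf (u : 'rV[R]_n) : \sum_j `|map_mx f u 0 j| ^+ 2 = f (\sum_j u 0 j ^+ 2).
  rewrite rmorph_sum; apply: eq_bigr => j _.
  by rewrite mxE normCK conjfE -expr2 rmorphXn.
have Aherm : AC \is hermsymmx.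
  apply/is_hermitianmxP; rewrite expr0 scale1r -map_trmx map_trmx.
  by rewrite /AC -{1}Asym; apply/matrixP => i j; rewrite !mxE; rewrite conjfE.
have Pu : P \is unitarymx by exact: spectral_unitarymx.
have AE : AC = invmx P *m diag_mx D *m P.
  exact/orthomx_spectralP/hermitian_normalmx.
have permD : perm_eq [seq D 0 i | i <- enum 'I_n] (map f (a :: ev)).
  apply: prod_XsubC_eq; rewrite big_map big_enum /= -(char_poly_unitary_diag Pu AE).
  by rewrite -map_char_poly chA map_prod_XsubC !big_cons big_map.
have [i0 Di0] : exists i0, D 0 i0 = f a.
  have : f a \in [seq D 0 i | i <- enum 'I_n] by rewrite (perm_mem permD) mem_head.
  by case/mapP => i _ ->; exists i.
(* Diagonal and spectrum agree as multisets, so deleting the index [i0] from one and [a] from the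
   other leaves exactly [ev]. *)
have Dsmall i : i != i0 -> `|D 0 i| <= f lambda.
  move=> ii0.
  have /perm_trans/(_ permD) : perm_eq (f a :: [seq D 0 j | j <- rem i0 (enum 'I_n)])
      [seq D 0 i | i <- enum 'I_n].
    by rewrite -Di0 -map_cons perm_map // perm_sym perm_to_rem // mem_enum.
  rewrite /= perm_cons => /perm_mem/(_ (D 0 i)).
  rewrite map_f ?(mem_rem_uniq, enum_uniq) ?inE ?ii0 ?mem_enum //.
  case/esym/mapP => z zev ->; rewrite /f normc_def /= expr0n addr0 sqrtr_sqr.
  by rewrite lecR; apply: evle.
pose eC := map_mx f e; pose xC := map_mx f x.
pose y := eC *m P^t*; pose z := xC *m P^t*.
have AP u : (u *m AC) *m P^t* = (u *m P^t*) *m diag_mx D.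
  rewrite AE -invmx_unitary // !mulmxA mulmxK //; exact: unitarymx_unit.
(* In the eigenbasis [eA] reads [y_i D_i = a y_i]; a nonzero [y_i] would give [D_i = a], against
   [|D_i| <= lambda < a]. *)
have y0 i : i != i0 -> y 0 i = 0.
  move=> ii0; have : (eC *m AC) *m P^t* = f a *: y.
    by rewrite -map_mxM eA map_mxZ -scalemxAl.
  rewrite AP => /rowP/(_ i); rewrite mul_mx_diag !mxE -/(y 0 i) => yi.
  apply/eqP; apply: contraTT la => yi0; rewrite -leNgt -lecR.
  have Di : D 0 i = f a.
    by apply: (mulfI yi0); rewrite yi mulrC.
  apply: le_trans (Dsmall _ ii0); rewrite Di /f normc_def /= expr0n addr0 sqrtr_sqr.
  by rewrite lecR ler_norm.
have yi0 : y 0 i0 != 0.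
  apply: contraNneq e0 => yi0; have yz : y = 0.
    by apply/rowP => i; rewrite [RHS]mxE; have [->//|/y0] := eqVneq i i0.
  have : eC = 0.
    have := mulmxKV (unitarymx_unit Pu) eC.
    by rewrite invmx_unitary // -/y yz mul0mx.
  move=> /rowP eC0; apply/eqP/rowP => i; have := eC0 i; rewrite !mxE.
  by move/eqP; rewrite fmorph_eq0 => /eqP.
have yE i : (y^t*) i 0 = (y 0 i)^* by rewrite 2!mxE.
have zi0 : z 0 i0 = 0.
  have : (z *m y^t*) 0 0 = 0.
    rewrite dot_unitary //; have -> : eC^t* = map_mx f e^T.
      by apply/matrixP => i j; rewrite !mxE conjfE.
    by rewrite -map_mxM xe map_mx0 mxE.
  rewrite mxE (bigD1 i0) //= big1 ?addr0 => [|i ii0]; last first.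
    by rewrite yE y0 // conjC0 mulr0.
  rewrite yE => /eqP; rewrite mulf_eq0 conjC_eq0 (negPf yi0) orbF.
  exact/eqP.
have normP (u : 'rV_n) : \sum_j `|u 0 j| ^+ 2 = \sum_j `|(u *m P^t*) 0 j| ^+ 2.
  by rewrite -!dot_selfE dot_unitary.
rewrite -lecR -/(f _) -/(f (_ * _)) rmorphM rmorphXn -!normf map_mxM -/xC -/AC.
rewrite normP AP -/z [X in _ <= _ * X]normP -/z mulr_sumr.
apply: ler_sum => i _.
rewrite mul_mx_diag mxE normrM exprMn mulrC.
have [->|ii0] := eqVneq i i0; first by rewrite zi0 normr0 expr0n !mulr0.
rewrite ler_wpM2r ?exprn_ge0 // lerXn2r ?nnegrE ?Dsmall //.
exact: le_trans (normr_ge0 _) (Dsmall _ ii0).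
Qed.
End Spectral.

Definition nbhd (G : sgraph) (v : G) : {set G} := [set y | adj v y].

Lemma card_nbhd (G : sgraph) d (v : G) : regular_graph G d -> #|nbhd v| = d.
Proof. by move=> /(_ v) <-; apply: eq_card => y; rewrite !inE. Qed.

Lemma sum_natr_card (R : pzSemiRingType) (T : finType) (P : pred T) :
  \sum_(v : T) ((P v)%:R : R) = #|[set v | P v]|%:R.
Proof.
rewrite -sum1_card natr_sum [RHS]big_mkcond /=; apply: eq_bigr => v _.
by rewrite inE; case: (P v).
Qed.

(** By sortedness every eigenvalue after the first lies between the last and the second one. *)
Lemma nontrivial_eigenvalue_le (R : realType) (n : nat) (a lambda : R) (ev : seq R) :
  sorted >=%R (a :: ev) -> size (a :: ev) = n ->
  lambda = Num.max `|(a :: ev)`_1| `|(a :: ev)`_n.-1| ->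
  forall z, z \in ev -> `|z| <= lambda.
Proof.
move=> srt sz -> z /(nthP 0) [i ilt <-].
have anti j k : (j <= k < n)%N -> (a :: ev)`_k <= (a :: ev)`_j.
  move=> /andP[jk kn].
  have tr : transitive (>=%R : rel R) by move=> x y w /= h1 h2; apply: le_trans h2 h1.
  have := sorted_leq_nth tr (@lexx _ R) 0 srt.
  by move=> /(_ j k); rewrite !inE sz kn (leq_ltn_trans jk kn) => /(_ erefl erefl jk).
have h1 : ev`_i <= (a :: ev)`_1 by apply: (anti 1%N i.+1); rewrite -sz.
have h2 : (a :: ev)`_n.-1 <= ev`_i.
  by apply: (anti i.+1 n.-1); rewrite -sz /= ilt ltnSn.
rewrite le_max; apply/orP; have [p|m] := lerP 0 ev`_i.
  by left; rewrite ger0_norm // (le_trans h1) // ler_norm.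
by right; rewrite ltr0_norm // -normrN (le_trans _ (ler_norm _)) // lerN2.
Qed.

(** The centred indicator [x] of [Y] is orthogonal to the all-ones eigenvector, and the coordinate
    of [x *m A] at [v] is the deviation of [#|nbhd v :&: Y|] from its average. The contraction bound
    then applies, with squared norm of [x] at most [#|Y|]. *)
Lemma spectral_discrepancy (R : realType) (n d : nat) (lambda : R) (G : sgraph)
    (Y : {set G}) :
  ndlambda_graph n d lambda G -> lambda < d%:R ->
  \sum_(v : G) (#|nbhd v :&: Y|%:R - d%:R * #|Y|%:R / n%:R) ^+ 2
    <= lambda ^+ 2 * #|Y|%:R.
Proof.
move=> [cG reg [ev [[srt chA] ev0 lamE]]] ld.
have szev : size ev = n.
  have := size_char_poly (adjacency_matrix R G).
  by rewrite chA size_prod_XsubC cG => -[].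
case: (posnP n) => [n0|n0].
  rewrite [X in X <= _]big1; first by rewrite mulr_ge0 ?sqr_ge0.
  by move=> v _; have := card0_eq (etrans cG n0) v; rewrite inE.
case: ev srt chA ev0 lamE szev => [|a ev] srt chA ev0 lamE szev.
  by rewrite -szev in n0.
have evle := nontrivial_eigenvalue_le srt szev lamE.
rewrite /= in ev0; rewrite -ev0 in ld *.
pose A := adjacency_matrix R G.
pose c : R := #|Y|%:R / n%:R.
pose x : 'rV[R]_#|G| := \row_i ((enum_val i \in Y)%:R - c).
pose e : 'rV[R]_#|G| := const_mx 1.
have nR : n%:R != 0 :> R by rewrite pnatr_eq0 -lt0n.
have sumG (F : G -> R) : \sum_(i < #|G|) F (enum_val i) = \sum_(v : G) F v.
  by rewrite [RHS](reindex (@enum_val G G)) //=; apply/onW_bij/enum_val_bij.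
have degE v : \sum_(u : G) ((adj u v)%:R : R) = a.
  rewrite ev0 -(card_nbhd v reg) sum_natr_card.
  by congr _%:R; apply: eq_card => u; rewrite !inE adj_sym.
have Asym : A^T = A by apply/matrixP => i j; rewrite !mxE adj_sym.
have eA : e *m A = a *: e.
  apply/rowP => j; rewrite !mxE mulr1 -(degE (enum_val j)) -sumG.
  by apply: eq_bigr => i _; rewrite !mxE mul1r.
have e0 : e != 0.
  have i0 : 'I_#|G| by rewrite cG; exact: Ordinal n0.
  by apply/eqP => /rowP/(_ i0)/eqP; rewrite !mxE oner_eq0.
have sumY : \sum_(v : G) ((v \in Y)%:R : R) = #|Y|%:R.
  by rewrite sum_natr_card; congr _%:R; apply: eq_card => v; rewrite inE.
have sumc : \sum_(v : G) c = #|Y|%:R.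
  by rewrite sumr_const cG -[c *+ n]mulr_natr /c divfK.
have xe : x *m e^T = 0.
  apply/matrixP => i j; rewrite !mxE; under eq_bigr do rewrite !mxE mulr1.
  by rewrite (sumG (fun v => (v \in Y)%:R - c)) sumrB sumY sumc subrr.
have xAE j : (x *m A) 0 j = #|nbhd (enum_val j) :&: Y|%:R - a * #|Y|%:R / n%:R.
  rewrite mxE; under eq_bigr do rewrite !mxE mulrBl.
  rewrite (sumG (fun v => (v \in Y)%:R * (adj v (enum_val j))%:R
                         - c * (adj v (enum_val j))%:R)).
  rewrite sumrB -mulr_sumr degE [c * a]mulrC mulrA; congr (_ - _).
  have -> : nbhd (enum_val j) :&: Y = [set v | (v \in Y) && adj v (enum_val j)].
    by apply/setP => v; rewrite !inE adj_sym andbC.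
  by rewrite -sum_natr_card; apply: eq_bigr => v _; rewrite -natrM mulnb.
have := contraction_off_eigenvector Asym chA evle ld eA e0 xe.
under eq_bigr do rewrite xAE.
rewrite (sumG (fun v => (#|nbhd v :&: Y|%:R - a * #|Y|%:R / n%:R) ^+ 2)).
move/le_trans; apply; rewrite ler_wpM2l ?sqr_ge0 //.
under eq_bigr do rewrite mxE.
rewrite (sumG (fun v => ((v \in Y)%:R - c) ^+ 2)).
(* An indicator equals its square, so the summand is affine in it; the total is [|Y| - c |Y|]. *)
have -> : \sum_(v : G) ((v \in Y)%:R - c) ^+ 2 =
    \sum_(v : G) ((1 - 2 * c) * (v \in Y)%:R + c * c).
  by apply: eq_bigr => v _; case: (v \in Y) => /=; ring.
rewrite big_split /= -[X in _ + X]mulr_sumr sumc -mulr_sumr sumY mulrBl mul1r.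
have : 0 <= c * #|Y|%:R by rewrite mulr_ge0 // divr_ge0.
lra.
Qed.

(** * Random subsets *)

Section RandomSubset.
Variables (R : realType) (T : finType).
Implicit Types (p : R) (S : {set T}) (f : {set T} -> R) (q : T).

Definition subset_weight p S : R := \prod_(x : T) (if x \in S then p else 1 - p).

(** Expectation for the [p]-random subset; probabilities appear below as means of 0/1 indicators. *)
Definition subset_mean p f : R := \sum_(S : {set T}) subset_weight p S * f S.

Lemma subset_weight_ge0 p S : 0 <= p <= 1 -> 0 <= subset_weight p S.
Proof.
by move=> /andP[p0 p1]; apply: prodr_ge0 => x _; case: ifP; rewrite ?subr_ge0.
Qed.

Lemma subset_mean1 p : subset_mean p (fun=> 1) = 1.
Proof.
rewrite /subset_mean; under eq_bigr do rewrite mulr1.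
transitivity (\prod_(x : T) (p + (1 - p))); last by rewrite big1 // => x _; ring.
by rewrite (@bigA_distr R 0 1 *%R +%R T (fun=> p) (fun=> 1 - p)).
Qed.

Lemma subset_mean_le p f g : 0 <= p <= 1 -> (forall S, f S <= g S) ->
  subset_mean p f <= subset_mean p g.
Proof.
by move=> p01 fg; apply: ler_sum => S _; rewrite ler_wpM2l ?subset_weight_ge0.
Qed.

Lemma subset_meanD p f g :
  subset_mean p (fun S => f S + g S) = subset_mean p f + subset_mean p g.
Proof. by rewrite -big_split; apply: eq_bigr => S _; rewrite mulrDr. Qed.

Lemma subset_meanZ p c f :
  subset_mean p (fun S => c * f S) = c * subset_mean p f.
Proof. by rewrite mulr_sumr; apply: eq_bigr => S _; rewrite mulrCA. Qed.

Lemma subset_mean_sum p (I : finType) (P : pred I) (F : I -> {set T} -> R) :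
  subset_mean p (fun S => \sum_(i | P i) F i S) = \sum_(i | P i) subset_mean p (F i).
Proof.
by rewrite exchange_big; apply: eq_bigr => S _; rewrite mulr_sumr.
Qed.

Lemma sum_subset_toggle q f :
  \sum_(S : {set T}) f S = \sum_(S : {set T} | q \notin S) (f S + f (q |: S)).
Proof.
rewrite (bigID (fun S : {set T} => q \notin S)) /= big_split; congr (_ + _).
rewrite (reindex_onto (fun S => q |: S) (fun S => S :\ q)) => [|S]; last first.
  by rewrite negbK => qS; rewrite setD1K.
apply: eq_bigl => S; rewrite !inE eqxx /=.
apply/eqP/idP => [<-|]; last exact: setU1K.
by rewrite !inE eqxx.
Qed.

(** Expresses that [f] does not depend on the membership of [q], hence is independent of the event
    [q \in S]. *)
Definition ignores q f := forall S, f (q |: S) = f (S :\ q).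

Lemma subset_mean_split q p f :
  subset_mean p f = \sum_(S : {set T} | q \notin S)
    \prod_(x | x != q) (if x \in S then p else 1 - p) * ((1 - p) * f S + p * f (q |: S)).
Proof.
rewrite /subset_mean (sum_subset_toggle q); apply: eq_bigr => S qS.
rewrite /subset_weight !(bigD1 q (P := predT)) //= (negPf qS) setU11.
have -> : \prod_(x | x != q) (if x \in q |: S then p else 1 - p) =
          \prod_(x | x != q) (if x \in S then p else 1 - p).
  by apply: eq_bigr => x /negPf xq; rewrite !inE xq.
by ring.
Qed.

Lemma subset_mean_in q p f : ignores q f ->
  subset_mean p (fun S => (q \in S)%:R * f S) = p * subset_mean p f.
Proof.
move=> fq; rewrite !(subset_mean_split q) mulr_sumr; apply: eq_bigr => S qS.
have -> : f (q |: S) = f S by rewrite fq; congr f; apply/setDidPl; rewrite disjoint_sym disjoints1.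
by rewrite (negPf qS) setU11 /= ?mulr0n ?mulr1n; ring.
Qed.

Lemma subset_mean_notin q p f : ignores q f ->
  subset_mean p (fun S => (q \notin S)%:R * f S) = (1 - p) * subset_mean p f.
Proof.
move=> fq; rewrite !(subset_mean_split q) mulr_sumr; apply: eq_bigr => S qS.
have -> : f (q |: S) = f S by rewrite fq; congr f; apply/setDidPl; rewrite disjoint_sym disjoints1.
by rewrite (negPf qS) setU11 /= ?mulr0n ?mulr1n; ring.
Qed.

Lemma mean_superset p (A : {set T}) :
  subset_mean p (fun S => (A \subset S)%:R) = p ^+ #|A|.
Proof.
have [m] := ubnP #|A|; elim: m A => // m IH A; rewrite ltnS => Am.
have [->|[q qA]] := set_0Vmem A.
  rewrite cards0 expr0 -[RHS](subset_mean1 p); apply: eq_bigr => S _.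
  by rewrite sub0set.
rewrite (cardsD1 q) qA exprS -IH; last by rewrite [#|A|](cardsD1 q) qA in Am.
rewrite -(subset_mean_in (q := q)); last first.
  move=> S; congr (nat_of_bool _)%:R; rewrite subsetD1 !inE eqxx /= andbT.
  apply/idP/idP => /subsetP h; apply/subsetP => x xA; have := h _ xA;
    move: xA; by rewrite !inE => /andP[/negPf xq _]; rewrite ?xq // => ->.
apply: eq_bigr => S _; congr (_ * _); rewrite -natrM mulnb.
by rewrite -{1}(setD1K qA) subUset sub1set.
Qed.

Lemma mean_disjoint p (Z : {set T}) :
  subset_mean p (fun S => [disjoint Z & S]%:R) = (1 - p) ^+ #|Z|.
Proof.
have [m] := ubnP #|Z|; elim: m Z => // m IH A; rewrite ltnS => Am.
have [->|[q qA]] := set_0Vmem A.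
  rewrite cards0 expr0 -[RHS](subset_mean1 p); apply: eq_bigr => S _.
  by rewrite -setI_eq0 set0I eqxx.
rewrite (cardsD1 q) qA exprS -IH; last by rewrite [#|A|](cardsD1 q) qA in Am.
rewrite -(subset_mean_notin (q := q)); last first.
  move=> S; congr (nat_of_bool _)%:R; rewrite -!setI_eq0; congr (_ == _).
  by apply/setP => x; rewrite !inE; case: (x == q).
apply: eq_bigr => S _; congr (_ * _); rewrite -natrM mulnb.
by rewrite -{1}(setD1K qA) -!setI_eq0 setIUl setU_eq0 !setI_eq0 disjoints1.
Qed.

(** Two-round exposure: an element is missed by both rounds with probability [(1 - p1) (1 - p2)].
    Each factor of the weight is split according to the first round, then according to the second,
    and the products of sums are expanded over [S1] and [S2]. *)
Lemma subset_weight_union p1 p2 S :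
  subset_weight (1 - (1 - p1) * (1 - p2)) S =
  \sum_(S1 : {set T}) \sum_(S2 : {set T} | S1 :|: S2 == S)
     subset_weight p1 S1 * subset_weight p2 S2.
Proof.
pose F x := if x \in S then p1 else 0.
pose G x := (1 - p1) * (if x \in S then p2 else 1 - p2).
transitivity (\prod_(x : T) (F x + G x)).
  by apply: eq_bigr => x _; rewrite /F /G; case: ifP => _; ring.
rewrite (@bigA_distr R 0 1 *%R +%R T F G); apply: eq_bigr => S1 _.
(* With [S1] fixed, [F'] and [G'] are the contributions of [x] inside and outside [S2]; their zero
   values kill every [S2] with [S1 :|: S2 != S]. *)
pose F' x := if x \in S then p2 else 0.
pose G' x := if x \in S1 then (x \in S)%:R * (1 - p2)
             else if x \in S then 0 else 1 - p2.
transitivity (subset_weight p1 S1 * \prod_(x : T) (F' x + G' x)).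
  rewrite -big_split; apply: eq_bigr => x _; rewrite /F /G /F' /G' /=.
  by do 2 case: ifP => _ /=; ring.
rewrite (@bigA_distr R 0 1 *%R +%R T F' G') mulr_sumr [RHS]big_mkcond /=.
apply: eq_bigr => S2 _; case: eqP => [SE|/eqP SN].
  congr (_ * _); apply: eq_bigr => x _; rewrite /F' /G' -SE !inE.
  by case: (x \in S1); case: (x \in S2); rewrite /= ?mul1r.
have [x xN] : exists x, (x \in S1 :|: S2) != (x \in S).
  apply/existsP; apply: contraNT SN; rewrite negb_exists => /forallP h.
  by apply/eqP/setP => x; apply/eqP; rewrite -[_ == _]negbK h.
rewrite (bigD1 x (P := predT)) //= [X in _ * (X * _)](_ : _ = 0) ?mul0r ?mulr0 //.
move: xN; rewrite /F' /G' !inE.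
by case: (x \in S1); case: (x \in S2); case: (x \in S); rewrite //= ?mul0r.
Qed.

Lemma subset_mean_union p1 p2 f :
  subset_mean (1 - (1 - p1) * (1 - p2)) f =
  subset_mean p1 (fun S1 => subset_mean p2 (fun S2 => f (S1 :|: S2))).
Proof.
rewrite /subset_mean; under eq_bigr do rewrite subset_weight_union mulr_suml.
rewrite exchange_big; apply: eq_bigr => S1 _; rewrite mulr_sumr.
under eq_bigr do rewrite mulr_suml big_mkcond.
rewrite exchange_big; apply: eq_bigr => S2 _.
rewrite (bigD1 (S1 :|: S2)) //= eqxx big1 ?addr0 ?mulrA // => S SN.
by rewrite eq_sym (negPf SN).
Qed.
End RandomSubset.

(** * Atypical sets *)

Definition nbhds (G : sgraph) (A : {set G}) : {set G} := \bigcup_(v in A) nbhd v.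

Section AtypicalSets.
Variables (R : realType) (G : sgraph) (n d : nat) (gamma M : R).
Implicit Types (A Z Y : {set G}) (v : G).

Definition poor_vertices Z : {set G} :=
  [set v | #|nbhd v :&: Z|%:R < (#|Z|%:R / n%:R - gamma) * d%:R].

(** Chebyshev's argument: each poor vertex contributes at least [(gamma d)^2] to the discrepancy sum
    of [Z]. *)
Lemma card_poor_vertices (lambda : R) Z :
  ndlambda_graph n d lambda G -> lambda < d%:R -> 0 <= gamma ->
  #|poor_vertices Z|%:R * (gamma * d%:R) ^+ 2 <= lambda ^+ 2 * n%:R.
Proof.
move=> ndl ld g0; have cG : #|G| = n by case: ndl.
have := spectral_discrepancy Z ndl ld; rewrite (bigID (mem (poor_vertices Z))) /=.
have hn : lambda ^+ 2 * #|Z|%:R <= lambda ^+ 2 * n%:R.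
  by rewrite ler_wpM2l ?sqr_ge0 // ler_nat -cG max_card.
move=> h; apply: le_trans hn; apply: le_trans h; rewrite -[leLHS]addr0 lerD //.
  rewrite mulr_natl -sumr_const; apply: ler_sum => v.
  rewrite inE mulrBl (_ : _ / _ * d%:R = d%:R * #|Z|%:R / n%:R); last by ring.
  have : 0 <= gamma * d%:R by rewrite mulr_ge0.
  set y := _ / n%:R; set g := gamma * _; set x := _%:R; nra.
by apply: sumr_ge0 => v _; apply: sqr_ge0.
Qed.

(* Sum, over the orderings of [A], of [M] to the number of vertices that are poor with
   respect to the part of [Z] left uncovered by their predecessors.  All [s`!] orderings
   of an atypical set have many such vertices, while the total over all sets of size [s]
   is at most [(2 n) ^ s]. *)
Fixpoint order_weight (s : nat) Z A : R :=
  if s is s'.+1 then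
    \sum_(v in A) M ^+ (v \in poor_vertices Z) * order_weight s' (Z :\: nbhd v) (A :\ v)
  else 1.

Hypothesis M1 : 1 <= M.

Lemma order_weight_ge_fact s Z A : #|A| = s -> s`!%:R <= order_weight s Z A.
Proof.
elim: s Z A => [|s IH] Z A As //=.
rewrite factS natrM -{1}As mulr_natl -sumr_const; apply: ler_sum => v vA.
rewrite -[leLHS]mul1r ler_pM ?exprn_ege1 //.
by apply: IH; move: As; rewrite (cardsD1 v) vA => -[].
Qed.

(** At least [z0] vertices of [Z] stay uncovered throughout, so a vertex that is not poor at its
    turn covers at least [tau] new ones. Covering at most [(s - j) tau] in all leaves at least [j]
    poor turns in every one of the [s!] orderings. *)
Lemma order_weight_ge s Z A (j : nat) (z0 tau : R) :
  #|A| = s -> 0 < tau -> tau <= (z0 / n%:R - gamma) * d%:R ->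
  z0 <= #|Z :\: nbhds A|%:R ->
  #|Z :&: nbhds A|%:R <= (s%:R - j%:R) * tau ->
  s`!%:R * M ^+ j <= order_weight s Z A.
Proof.
move=> As t0 tle; elim: s Z A j As => [|s IH] Z A j As hz hm.
  suff -> : j = 0%N by rewrite /= mulr1.
  have : 0 <= (0%:R - j%:R) * tau by apply: le_trans hm.
  rewrite pmulr_lge0 // sub0r oppr_ge0 => h; apply/eqP.
  by rewrite -leqn0 -(ler_nat R).
rewrite /= factS natrM -mulrA -{1}As mulr_natl -sumr_const; apply: ler_sum => v vA.
have As' : #|A :\ v| = s by move: As; rewrite (cardsD1 v) vA => -[].
have NA : nbhds A = nbhd v :|: nbhds (A :\ v) by rewrite /nbhds (big_setD1 v).
have hz' : z0 <= #|(Z :\: nbhd v) :\: nbhds (A :\ v)|%:R by rewrite setDDl -NA.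
have cm : #|Z :&: nbhds A|%:R =
    #|nbhd v :&: Z|%:R + #|(Z :\: nbhd v) :&: nbhds (A :\ v)|%:R :> R.
  rewrite -natrD -(cardsID (nbhd v) (Z :&: _)) NA; congr ((_ + _)%:R).
    by apply: eq_card => x; rewrite !inE; case: (adj v x); rewrite ?andbT ?andbF.
  by apply: eq_card => x; rewrite !inE; case: (adj v x); rewrite ?andbT ?andbF.
(* A poor first vertex supplies a factor [M] and lowers [j]; any other one uses up [tau] of the
   covering allowance. *)
have [vb|vg] := boolP (v \in poor_vertices Z).
  case: j hm => [|j] hm.
    rewrite !expr0 mulr1 -[leLHS]mul1r ler_pM //; exact: order_weight_ge_fact.
  rewrite expr1 exprS mulrCA ler_wpM2l ?(le_trans ler01) //; apply: IH => //.
  have : 0 <= #|nbhd v :&: Z|%:R :> R by [].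
  move: hm; rewrite cm -!natr1; lra.
rewrite expr0 mul1r; apply: IH => //.
have hv : tau <= #|nbhd v :&: Z|%:R.
  move: vg; rewrite inE -leNgt; apply: le_trans; apply: le_trans tle _.
  rewrite ler_wpM2r // lerD2r ler_wpM2r ?invr_ge0 // (le_trans hz) // ler_nat.
  exact/subset_leq_card/subsetDl.
move: hm; rewrite cm -natr1; lra.
Qed.

Hypothesis poor_few : forall Z, M * #|poor_vertices Z|%:R <= n%:R.
Hypothesis cardG : #|G| = n.

(** Summing over the first vertex of the ordering costs a factor at most
    [n + M * #|poor_vertices Z| <= 2 n], whatever the part of [Z] still uncovered; induction gives
    the power. *)
Lemma sum_order_weight s Z :
  \sum_(A : {set G} | #|A| == s) order_weight s Z A <= (2 * n%:R) ^+ s.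
Proof.
have M0 : 0 <= M by apply: le_trans M1.
elim: s Z => [|s IH] Z.
  rewrite (big_pred1 set0) ?expr0 // => A; exact: cards_eq0.
rewrite /=.
pose W v B := M ^+ (v \in poor_vertices Z) * order_weight s (Z :\: nbhd v) B.
have -> : \sum_(A : {set G} | #|A| == s.+1) \sum_(v in A) W v (A :\ v) =
    \sum_v \sum_(B : {set G} | (#|B| == s) && (v \notin B)) W v B.
  rewrite (exchange_big_dep predT) //=; apply: eq_bigr => v _.
  rewrite (reindex_onto (fun B => v |: B) (fun A => A :\ v)) => [|A /andP[_ vA]].
    apply: eq_big => B => [|/andP[_ /eqP->]//].
    rewrite setU11 andbT; have [vB|vB] /= := boolP (v \in B).
      rewrite andbF; apply/negbTE/negP => /andP[_ /eqP h].
      by move: vB; rewrite -h !inE eqxx.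
    by rewrite setU1K // eqxx andbT cardsU1 vB andbT.
  exact: setD1K.
have W0 v (B : {set G}) : #|B| = s -> 0 <= W v B.
  move=> Bs; rewrite mulr_ge0 ?exprn_ge0 //.
  exact: le_trans (ler0n _ _) (order_weight_ge_fact _ Bs).
apply: (@le_trans _ _ (\sum_v M ^+ (v \in poor_vertices Z) * (2 * n%:R) ^+ s)).
  apply: ler_sum => v _.
  apply: (@le_trans _ _ (\sum_(B : {set G} | #|B| == s) W v B)).
    rewrite big_mkcondr; apply: ler_sum => B /eqP /(W0 v) h; by case: ifP.
  by rewrite -mulr_sumr ler_wpM2l ?IH // exprn_ge0.
rewrite -mulr_suml exprS ler_wpM2r ?exprn_ge0 ?mulr_ge0 //.
apply: (@le_trans _ _ (\sum_(v : G) (1 + M * (v \in poor_vertices Z)%:R))).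
  apply: ler_sum => v _; case: (v \in _) => /=; rewrite ?expr1 ?expr0; lra.
rewrite big_split /= sumr_const cardG -mulr_sumr sum_natr_card.
rewrite (_ : [set v | v \in _] = poor_vertices Z); last by apply/setP => v; rewrite inE.
have := poor_few Z; lra.
Qed.

(** Double counting: a set covering fewer than [theta] vertices of [Y] has order weight at least
    [s! M^k], while the total weight is at most [(2 n)^s]. *)
Lemma count_atypical (s k : nat) Y (theta : R) :
  let tau := ((#|Y|%:R - theta) / n%:R - gamma) * d%:R in
  0 < tau -> theta <= (s%:R - k%:R) * tau ->
  s`!%:R * M ^+ k * #|[set A : {set G} | (#|A| == s) && (#|Y :&: nbhds A|%:R < theta)]|%:R
    <= (2 * n%:R) ^+ s.
Proof.
move=> tau t0 hk; apply: le_trans (sum_order_weight s Y).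
rewrite [X in X <= _]mulr_natr -sumr_const (eq_bigl _ _ (in_set _)) [leRHS]big_mkcond.
rewrite [leLHS]big_mkcond; apply: ler_sum => A _; case: eqP => //= As.
case: ifP => h; last first.
  exact: le_trans (ler0n _ _) (order_weight_ge_fact _ As).
apply: (@order_weight_ge _ _ _ _ (#|Y|%:R - theta) tau) => //.
  by rewrite lerBlDr -(cardsID (nbhds A) Y) natrD addrC lerD2l ltW.
exact: le_trans (ltW h) hk.
Qed.
End AtypicalSets.

(** * Depth-first search *)

Section DepthFirstSearch.
Variables (G : sgraph) (x0 : G).
Implicit Types (O : {set G}) (t : nat).

(** [dfs_open] keeps all queried vertices found in the random set, including those on the stack;
    [dfs_closed] keeps those found outside it. The head of the list is the top of the stack. *)
Record dfs_state := DfsState {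
  dfs_stack : seq G; dfs_open : {set G}; dfs_closed : {set G} }.
Implicit Types (st : dfs_state).

Definition queried st := dfs_open st :|: dfs_closed st.

Definition live st (u : G) := [exists v, adj u v && (v \notin queried st)].

(* Vertices without unqueried neighbours are popped lazily, so that every step makes
   exactly one query. *)
Definition trimmed_stack st := drop (find (live st) (dfs_stack st)) (dfs_stack st).

(** An empty trimmed stack starts a new tree at any unqueried vertex. The default [x0] is reached
    only when every vertex has been queried. *)
Definition next_query st : G :=
  odflt x0 (if trimmed_stack st is u :: _ then [pick v | adj u v && (v \notin queried st)]
            else [pick v | v \notin queried st]).

Definition dfs_next st (b : bool) :=
  let v := next_query st in
  if b then DfsState (v :: trimmed_stack st) (v |: dfs_open st) (dfs_closed st)
  else DfsState (trimmed_stack st) (dfs_open st) (v |: dfs_closed st).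

Fixpoint dfs_run O t st :=
  if t is t'.+1 then dfs_run O t' (dfs_next st (next_query st \in O)) else st.

Lemma trimmed_head_live st u s : trimmed_stack st = u :: s -> live st u.
Proof.
rewrite /trimmed_stack => E.
have h : has (live st) (dfs_stack st).
  rewrite has_find ltnNge; apply/negP => /drop_oversize; by rewrite E.
by have := nth_find u h; rewrite -[find _ _]addn0 -nth_drop E.
Qed.

Lemma next_query_fresh st : queried st != setT -> next_query st \notin queried st.
Proof.
move=> qT; rewrite /next_query; case E: (trimmed_stack st) => [|u s].
  case: pickP => [//|h]; case/eqP: qT; apply/setP => v; rewrite [RHS]inE.
  by have /negbFE := h v.
case: pickP => [v /andP[]//|h].
by have /existsP[v] := trimmed_head_live E; rewrite h.
Qed.

Lemma next_query_adj st u s : trimmed_stack st = u :: s -> adj u (next_query st).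
Proof.
move=> E; rewrite /next_query E; case: pickP => [v /andP[]//|h].
by have /existsP[v] := trimmed_head_live E; rewrite h.
Qed.

Lemma queried_next st b : queried (dfs_next st b) = next_query st |: queried st.
Proof. by case: b; apply/setP => x; rewrite /queried /= !inE; case: (x == _); rewrite ?orbT. Qed.

Lemma queried_run_neqT st t : (#|queried st| + t.+1 <= #|G|)%N -> queried st != setT.
Proof. by apply: contraTneq => ->; rewrite cardsT addnS ltnNge leq_addr. Qed.

Lemma card_queried_next st b t : (#|queried st| + t.+1 <= #|G|)%N ->
  #|queried (dfs_next st b)| = #|queried st|.+1.
Proof. by move=> h; rewrite queried_next cardsU1 next_query_fresh ?(queried_run_neqT h). Qed.

Lemma card_queried_run O t st : (#|queried st| + t <= #|G|)%N ->
  #|queried (dfs_run O t st)| = (#|queried st| + t)%N.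
Proof.
elim: t st => [|t IH] st h; first by rewrite addn0.
by rewrite /= IH (card_queried_next _ h) ?addSnnS.
Qed.

(** The stack is a path inside [O], and an open vertex that has left it has no unqueried
    neighbour. *)
Definition dfs_inv O st := [/\ uniq (dfs_stack st), {subset dfs_stack st <= dfs_open st},
  dfs_open st \subset O, sorted (@adj G) (dfs_stack st) &
  forall u, u \in dfs_open st -> u \notin dfs_stack st -> nbhd u \subset queried st].

Lemma dfs_inv_next O st : queried st != setT -> dfs_inv O st ->
  dfs_inv O (dfs_next st (next_query st \in O)).
Proof.
move=> /next_query_fresh fr [un sub opO srt nb].
set v := next_query st in fr *.
have subt : {subset trimmed_stack st <= dfs_stack st} by move=> x /mem_drop.
have unt : uniq (trimmed_stack st) by apply: drop_uniq.
have srtt : sorted (@adj G) (trimmed_stack st).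
  have := srt; rewrite -{1}(cat_take_drop (find (live st) (dfs_stack st)) (dfs_stack st)).
  by move=> /cat_sorted2[].
(* Vertices removed by trimming precede the first live one, so they are not live. *)
have nbt u : u \in dfs_open st -> u \notin trimmed_stack st -> nbhd u \subset queried st.
  move=> uo ut; have [us|] := boolP (u \in dfs_stack st); last exact: nb.
  have : u \in take (find (live st) (dfs_stack st)) (dfs_stack st).
    move: us; rewrite -{1}(cat_take_drop (find (live st) (dfs_stack st)) (dfs_stack st)).
    by rewrite mem_cat (negPf ut) orbF.
  have : ~~ has (live st) (take (find (live st) (dfs_stack st)) (dfs_stack st)).
    by rewrite has_take_leq ?find_size // ltnn.
  rewrite -all_predC => /allP nla /nla nl.
  apply/subsetP => w; rewrite inE => uw; apply: contraNT nl => wq.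
  by apply/existsP; exists w; rewrite uw.
have vo : v \notin dfs_open st by apply: contra fr; rewrite !inE => ->.
have qs b : queried st \subset queried (dfs_next st b) by rewrite queried_next subsetUr.
case vO: (v \in O); split => //=; rewrite /dfs_next -/v /=.
- rewrite unt andbT; apply: contra vo => /subt; exact: sub.
- move=> x; rewrite !inE => /orP[->//|/subt/sub->]; exact: orbT.
- by rewrite subUset sub1set vO.
- case E: (trimmed_stack st) srtt => [|u s] //= ->.
  by rewrite andbT adj_sym (next_query_adj E).
- move=> u; rewrite !inE => /orP[->//|uo]; rewrite negb_or => /andP[_ ut].
  exact: subset_trans (nbt u uo ut) (qs true).
- by move=> x /subt/sub.
- by move=> u uo ut; exact: subset_trans (nbt u uo ut) (qs false).
Qed.

Lemma dfs_inv_run O t st : (#|queried st| + t <= #|G|)%N -> dfs_inv O st ->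
  dfs_inv O (dfs_run O t st).
Proof.
elim: t st => [|t IH] st h inv //=; apply: IH.
  by rewrite (card_queried_next _ h) addSnnS.
exact/dfs_inv_next/inv/(queried_run_neqT h).
Qed.

Definition site_dfs O t := dfs_run O t (DfsState [::] set0 set0).

Lemma site_dfsP O t : (t <= #|G|)%N ->
  dfs_inv O (site_dfs O t) /\ #|queried (site_dfs O t)| = t.
Proof.
move=> tn; have q0 : #|queried (DfsState [::] set0 set0)| = 0%N.
  by rewrite /queried setU0 cards0.
split; last by rewrite card_queried_run q0.
by apply: dfs_inv_run; rewrite ?q0 //; split=> //= [|u]; rewrite ?sub0set ?inE.
Qed.

(** No vertex is queried twice. This makes the answer to a query independent of the rest of the
    run. *)
Lemma dfs_run_ignores O t st q : (#|queried st| + t <= #|G|)%N -> q \in queried st ->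
  dfs_run (q |: O) t st = dfs_run (O :\ q) t st.
Proof.
elim: t st => [|t IH] st h qq //=.
have qv : next_query st != q.
  by apply: contraTneq qq => <-; apply/next_query_fresh/(queried_run_neqT h).
rewrite !inE (negPf qv) /=; apply: IH; first by rewrite (card_queried_next _ h) addSnnS.
by rewrite queried_next inE qq orbT.
Qed.

(** Generating function of a binomial count: the [t] answers act as independent trials, because
    after conditioning on the current query the remaining run ignores that vertex. *)
Lemma mean_dfs_run (R : realType) (p rho : R) t st : (#|queried st| + t <= #|G|)%N ->
  subset_mean p (fun O => rho ^+ #|dfs_open (dfs_run O t st)|) =
  rho ^+ #|dfs_open st| * (1 - p + p * rho) ^+ t.
Proof.
elim: t st => [|t IH] st h.
  rewrite expr0 mulr1 -[RHS]mulr1 -(subset_mean1 G p) -subset_meanZ.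
  by under [RHS]eq_bigr do rewrite mulr1.
set v := next_query st.
have fr : v \notin queried st by apply/next_query_fresh/(queried_run_neqT h).
have vo : v \notin dfs_open st by apply: contra fr; rewrite !inE => ->.
have h' b : (#|queried (dfs_next st b)| + t <= #|G|)%N.
  by rewrite (card_queried_next _ h) addSnnS.
pose f b O := rho ^+ #|dfs_open (dfs_run O t (dfs_next st b))| : R.
have ign b : ignores v (f b).
  by move=> O; rewrite /f dfs_run_ignores // queried_next setU11.
transitivity (subset_mean p (fun O => (v \in O)%:R * f true O + (v \notin O)%:R * f false O)).
  apply: eq_bigr => O _; congr (_ * _); rewrite /f /= -/v.
  by case: (v \in O); rewrite /= mul0r mul1r ?addr0 ?add0r.
rewrite subset_meanD (subset_mean_in p (ign true)) (subset_mean_notin p (ign false)) /f.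
rewrite (IH _ (h' true)) (IH _ (h' false)) /=.
by rewrite cardsU1 vo add1n !exprS; ring.
Qed.
End DepthFirstSearch.

(** * Closing a long path *)

Lemma sub_seq_of_sig (T : eqType) (P : pred T) (s : seq T) :
  all P s -> exists s' : seq {x | P x}, map val s' = s.
Proof.
elim: s => [|x s IH] /=; first by exists [::].
by move=> /andP[Px /IH[s' <-]]; exists (exist _ x Px :: s').
Qed.

Lemma has_cycle_ge_induced (R : realType) (G : sgraph) (O : {set G}) (s : seq G) (L : R) :
  {subset s <= O} -> uniq s -> cycle (@adj G) s -> (3 <= size s)%N -> L <= (size s)%:R ->
  has_cycle_ge (induced_subgraph O) L.
Proof.
move=> sO us cs s3 Ls; have [s' E] := sub_seq_of_sig (introT allP sO).
exists s'; rewrite -(size_map val) E; split => //; apply/andP; split.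
  by move: cs; rewrite -E cycle_map.
by rewrite -(map_inj_uniq val_inj) E.
Qed.

(** The cycle goes from a neighbour [a] of [v] in [P1] along the path to a neighbour [b] in [P3] and
    back through [v]; it contains [P2] besides [a], [b] and [v]. *)
Lemma close_path (G : sgraph) (P1 P2 P3 : seq G) (v : G) :
  sorted (@adj G) (P1 ++ P2 ++ P3) -> uniq (P1 ++ P2 ++ P3) -> v \notin P1 ++ P2 ++ P3 ->
  v \in nbhds [set x in P1] -> v \in nbhds [set x in P3] ->
  exists s : seq G, [/\ {subset s <= v :: P1 ++ P2 ++ P3}, uniq s, cycle (@adj G) s &
     (3 + size P2 <= size s)%N].
Proof.
move=> srt un vP /bigcupP[a]; rewrite !inE => aP1 va /bigcupP[b]; rewrite !inE => bP3 vb.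
case/splitPr: aP1 srt un vP => l1 l2; case/splitPr: bP3 => l3 l4.
have -> : (l1 ++ a :: l2) ++ P2 ++ l3 ++ b :: l4 = l1 ++ (a :: l2 ++ P2 ++ rcons l3 b) ++ l4.
  by rewrite -!catA /= -!catA cat_rcons.
set mid := a :: _ => srt un vP.
have srtm : sorted (@adj G) mid.
  by move: srt => /cat_sorted2[_ /cat_sorted2[]].
have unm : uniq mid by move: un; rewrite !cat_uniq => /and3P[_ _ /and3P[]].
exists (v :: mid); split.
- move=> x; rewrite in_cons => /orP[/eqP->|h]; first exact: mem_head.
  by rewrite in_cons [_ \in l1 ++ _]mem_cat [_ \in mid ++ _]mem_cat h !orbT.
- rewrite cons_uniq unm andbT; apply: contra vP => h.
  by rewrite mem_cat [_ \in mid ++ _]mem_cat h !orbT.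
- rewrite /= rcons_path adj_sym va /=; move: srtm; rewrite /= => ->.
  by rewrite !last_cat last_rcons.
- rewrite /= !size_cat size_rcons; lia.
Qed.

Lemma mean_exists_subset (R : realType) (T : finType) (p : R) (F : {set {set T}}) :
  0 <= p <= 1 ->
  subset_mean p (fun S => [exists A in F, A \subset S]%:R) <= \sum_(A in F) p ^+ #|A|.
Proof.
move=> p01; under [leRHS]eq_bigr do rewrite -mean_superset.
rewrite -subset_mean_sum; apply: subset_mean_le => // S.
have nn (A : {set T}) : 0 <= (A \subset S)%:R :> R by [].
case: existsP => [[A /andP[AF AS]]|_] /=; last by apply: sumr_ge0.
by rewrite (bigD1 A) //= AS lerDl; apply: sumr_ge0.
Qed.

(** Markov's inequality for [rho ^+ #|dfs_open|], which is at least [rho ^+ m] on the event as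
    [rho <= 1]. *)
Lemma mean_few_open (R : realType) (G : sgraph) (x0 : G) (p rho : R) (t m : nat) :
  0 <= p <= 1 -> 0 < rho <= 1 -> (t <= #|G|)%N ->
  subset_mean p (fun O => (#|dfs_open (site_dfs x0 O t)| < m)%N%:R)
    <= (1 - p + p * rho) ^+ t / rho ^+ m.
Proof.
move=> p01 /andP[r0 r1] tn; rewrite ler_pdivlMr ?exprn_gt0 // mulrC -subset_meanZ.
have := mean_dfs_run x0 p rho (t := t) (st := DfsState [::] set0 set0).
rewrite /queried /= setU0 cards0 expr0 mul1r => /(_ tn) <-.
apply: subset_mean_le => // O; case: ltnP => h; last by rewrite mulr0 exprn_ge0 // ltW.
by rewrite mulr1 ler_wiXn2l ?(ltW r0) // ltnW.
Qed.

(** If the stack had fewer than [l] vertices, at least [s] open vertices would be off it, with all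
    neighbours among the [t] queried vertices; but [s] vertices of [O] have at least [theta > t]
    neighbours. *)
Lemma dfs_long_path (R : realType) (G : sgraph) (x0 : G) (O : {set G}) (t m s l : nat)
    (theta : R) :
  (t <= #|G|)%N -> (s + l <= m)%N -> t%:R < theta ->
  (m <= #|dfs_open (site_dfs x0 O t)|)%N ->
  (forall A : {set G}, #|A| = s -> A \subset O -> theta <= #|nbhds A|%:R) ->
  exists P : seq G, [/\ uniq P, {subset P <= O}, sorted (@adj G) P & size P = l].
Proof.
move=> tn slm tth mo typ; have [[un sub opO srt nb] cq] := site_dfsP x0 O tn.
set st := site_dfs x0 O t in mo un sub opO srt nb cq.
have [ls|ls] := leqP l (size (dfs_stack st)).
  exists (take l (dfs_stack st)); split.
  - exact: take_uniq.
  - by move=> x /mem_take/sub/(subsetP opO).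
  - by have := srt; rewrite -{1}(cat_take_drop l (dfs_stack st)) => /cat_sorted2[].
  - exact: size_takel.
pose D := dfs_open st :\: [set x in dfs_stack st].
have sD : (s <= #|D|)%N.
  have := cardsD (dfs_open st) [set x in dfs_stack st]; rewrite -/D.
  have : (#|dfs_open st :&: [set x in dfs_stack st]| <= size (dfs_stack st))%N.
    apply: leq_trans (subset_leq_card (subsetIr _ _)) _.
    by rewrite cardsE card_size.
  lia.
have [A AD As] : exists2 A : {set G}, A \subset D & #|A| = s.
  have /card_geqP[l' [ul sl lD]] := sD; exists [set x in l'].
    by apply/subsetP => x; rewrite inE; apply: lD.
  by rewrite cardsE (card_uniqP ul).
have Aop : A \subset dfs_open st by apply: subset_trans AD (subsetDl _ _).
have := typ A As (subset_trans Aop opO); rewrite leNgt => /negP[].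
apply: le_lt_trans tth; rewrite ler_nat -cq; apply: subset_leq_card.
apply/bigcupsP => u uA; apply: nb; first exact: (subsetP Aop).
by have := subsetP AD _ uA; rewrite !inE => /andP[].
Qed.

Lemma has_cycle_ge_weaken (R : realType) (G : sgraph) (L L' : R) :
  L <= L' -> has_cycle_ge G L' -> has_cycle_ge G L.
Proof. by move=> LL' [s [cs s3 Ls]]; exists s; split=> //; apply: le_trans Ls. Qed.

(** * Failure probability of the two-round exposure *)

Definition atypical (R : realType) (G : sgraph) (s : nat) (Y : {set G}) (theta : R) :
    {set {set G}} :=
  [set A : {set G} | (#|A| == s) && (#|Y :&: nbhds A|%:R < theta)].

Lemma ffact_le_expn (n m : nat) : (n ^_ m <= n ^ m)%N.
Proof.
elim: m => // m IH; rewrite ffactnSr expnSr leq_mul //; exact: leq_subr.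
Qed.

Lemma card_draws_le (R : realType) (T : finType) (s : nat) :
  #|[set A : {set T} | #|A| == s]|%:R <= #|T|%:R ^+ s / s`!%:R :> R.
Proof.
rewrite ler_pdivlMr ?ltr0n ?fact_gt0 // -natrM -natrX ler_nat.
by rewrite card_draws bin_ffact ffact_le_expn.
Qed.

Section Failure.
Variables (R : realType) (G : sgraph) (n d : nat) (gamma M : R).
Hypothesis M1 : 1 <= M.
Hypothesis poor_few : forall Z : {set G}, M * #|poor_vertices n d gamma Z|%:R <= n%:R.
Hypothesis cardG : #|G| = n.
Implicit Types (A B Y Z O : {set G}) (s k t m L : nat) (p theta : R).

(** Bounds the expected number of atypical sets inside the random set: each has probability [p^s],
    and [count_atypical] bounds their number. *)
Lemma sum_atypical p s k Y theta :
  let tau := ((#|Y|%:R - theta) / n%:R - gamma) * d%:R in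
  0 <= p -> 0 < tau -> theta <= (s%:R - k%:R) * tau ->
  \sum_(A in atypical s Y theta) p ^+ #|A| <= (2 * n%:R * p) ^+ s / (s`!%:R * M ^+ k).
Proof.
move=> tau p0 t0 hk; have := count_atypical M1 poor_few cardG t0 hk.
have M0 : 0 < M by apply: lt_le_trans M1.
rewrite -/(atypical s Y theta) => h.
rewrite (eq_bigr (fun=> p ^+ s)) => [|A]; last by rewrite inE => /andP[/eqP->].
rewrite ler_pdivlMr ?mulr_gt0 ?exprn_gt0 ?ltr0n ?fact_gt0 //.
rewrite sumr_const -mulr_natl [X in _ <= X]exprMn.
rewrite [leLHS](_ : _ = s`!%:R * M ^+ k * #|atypical s Y theta|%:R * p ^+ s); last by ring.
by rewrite ler_wpM2r ?exprn_ge0.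
Qed.

(** [B] expands well, yet [A] reaches few of its neighbours. Disjointness gives the event
    [A :|: B \subset O] probability [p^(2s)] when both sets have size [s]. *)
Definition atypical_pair s theta theta' O := [exists B : {set G}, exists A : {set G},
  [&& #|B| == s, theta <= #|nbhds B|%:R, A \in atypical s (nbhds B) theta',
      [disjoint A & B] & A :|: B \subset O]].

(** Union bound over at most [n^s / s!] sets [B], then over the sets [A] atypical for [nbhds B]. *)
Lemma mean_atypical_pair p s k theta theta' :
  let tau := ((theta - theta') / n%:R - gamma) * d%:R in
  0 <= p <= 1 -> (k <= s)%N -> 0 < tau -> theta' <= (s%:R - k%:R) * tau ->
  subset_mean p (fun O => (atypical_pair s theta theta' O)%:R) <=
  (n%:R * p) ^+ s / s`!%:R * ((2 * n%:R * p) ^+ s / (s`!%:R * M ^+ k)).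
Proof.
move=> tau p01 ks t0 hk; have p0 : 0 <= p by case/andP: p01.
set bnd := (2 * _ * _) ^+ s / _.
have M0 : 0 <= M by apply: le_trans M1.
have bnd0 : 0 <= bnd by rewrite /bnd divr_ge0 ?exprn_ge0 ?mulr_ge0 ?exprn_ge0.
apply: (@le_trans _ _ (\sum_(B in [set B : {set G} | #|B| == s]) p ^+ s * bnd)); last first.
  rewrite sumr_const -[leLHS]mulr_natl mulrA ler_wpM2r //.
  rewrite exprMn mulrAC ler_wpM2r ?exprn_ge0 // -cardG; exact: card_draws_le.
apply: (@le_trans _ _ (\sum_(B in [set B : {set G} | #|B| == s])
   \sum_(A in atypical s (nbhds B) theta' | (theta <= #|nbhds B|%:R) && [disjoint A & B])
     subset_mean p (fun O => (A :|: B \subset O)%:R))).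
  under eq_bigr do rewrite -subset_mean_sum.
  rewrite -subset_mean_sum; apply: subset_mean_le => // O.
  have nn B : 0 <= \sum_(A in atypical s (nbhds B) theta' |
    (theta <= #|nbhds B|%:R) && [disjoint A & B]) (A :|: B \subset O)%:R :> R.
    by apply: sumr_ge0 => A _.
  rewrite /atypical_pair.
  case: existsP => [[B /existsP[A /and5P[Bs hB Aat dAB sO]]]|_]; last exact: sumr_ge0.
  rewrite (bigD1 B) /= ?inE // -[leLHS]addr0 lerD ?sumr_ge0 //.
  by rewrite (bigD1 A) /= ?Aat ?hB // sO lerDl sumr_ge0.
apply: ler_sum => B; rewrite inE => /eqP Bs.
have [hB|hB] := lerP theta #|nbhds B|%:R; last first.
  rewrite big1 => [|A]; last by rewrite andbF.
  by rewrite mulr_ge0 ?exprn_ge0.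
(* The value of [tau] computed from the lower bound [theta] serves all [B] at once, since a larger
   neighbourhood only increases it. *)
have tauB : tau <= ((#|nbhds B|%:R - theta') / n%:R - gamma) * d%:R.
  by rewrite ler_wpM2r // lerD2r ler_wpM2r ?invr_ge0 // lerD2r.
have := @sum_atypical p s k (nbhds B) theta' p0 (lt_le_trans t0 tauB).
move=> /(_ _)/le_trans; rewrite -/bnd => h.
apply: (@le_trans _ _ (p ^+ s * \sum_(A in atypical s (nbhds B) theta') p ^+ #|A|)).
  rewrite mulr_sumr big_mkcondr; apply: ler_sum => A Aat; case: ifP => [dAB|_].
    rewrite mean_superset cardsU; move: dAB; rewrite /= -setI_eq0 => /eqP->.
    by rewrite cards0 subn0 exprD Bs mulrC.
  by rewrite mulr_ge0 ?exprn_ge0.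
rewrite ler_wpM2l ?exprn_ge0 //; apply: h => //; apply: le_trans hk _.
by rewrite ler_wpM2l // subr_ge0 ler_nat.
Qed.

Definition no_cycle L O : bool :=
  ~~ `[< has_cycle_ge (induced_subgraph O) (L%:R : R) >].

Lemma mean_atypical p s k theta :
  let tau := ((n%:R - theta) / n%:R - gamma) * d%:R in
  0 <= p <= 1 -> 0 < tau -> theta <= (s%:R - k%:R) * tau ->
  subset_mean p (fun O => [exists A in atypical s setT theta, A \subset O]%:R)
    <= (2 * n%:R * p) ^+ s / (s`!%:R * M ^+ k).
Proof.
move=> tau p01 t0 hk; apply: le_trans (mean_exists_subset _ p01) _.
by apply: sum_atypical; rewrite ?cardsT ?cardG //; case/andP: p01.
Qed.

(** [Z] consists of the common neighbours of the first and last thirds of [P] that lie off [P].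
    Opening any of them closes a cycle through the middle third; the term [3 L] pays for removing
    [P]. *)
Lemma sprinkled_cycle O L z theta theta' (P : seq G) :
  uniq P -> {subset P <= O} -> sorted (@adj G) P -> size P = (3 * L)%N ->
  (forall A, #|A| = L -> A \subset O -> theta <= #|nbhds A|%:R) ->
  ~~ atypical_pair L theta theta' O ->
  z%:R + (3 * L)%:R <= theta' ->
  exists2 Z : {set G}, (z <= #|Z|)%N & forall O', no_cycle L (O :|: O') -> [disjoint Z & O'].
Proof.
move=> un sub srt szP typ napair zth.
pose P1 := take L P; pose P2 := take L (drop L P); pose P3 := drop L (drop L P).
have PE : P = P1 ++ P2 ++ P3 by rewrite !cat_take_drop.
have sz1 : size P1 = L by rewrite size_takel // szP; lia.
have sz2 : size P2 = L by rewrite size_takel // size_drop szP; lia.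
have sz3 : size P3 = L by rewrite !size_drop szP; lia.
have sub1 : {subset P1 <= P} by move=> x xP; rewrite PE mem_cat xP.
have sub3 : {subset P3 <= P} by move=> x xP; rewrite PE !mem_cat xP !orbT.
move: (un); rewrite {1}PE !cat_uniq => /and3P[un1 dis /and3P[un2 _ un3]].
pose A := [set x in P1]; pose B := [set x in P3].
have cA : #|A| = L by rewrite cardsE (card_uniqP un1).
have cB : #|B| = L by rewrite cardsE (card_uniqP un3).
have AO : A \subset O by apply/subsetP => x; rewrite inE => /sub1/sub.
have BO : B \subset O by apply/subsetP => x; rewrite inE => /sub3/sub.
have dAB : [disjoint A & B].
  rewrite -setI_eq0; apply/eqP/setP => x; rewrite !inE; apply/negP => /andP[x1 x3].
  by move/hasPn: dis => /(_ x); rewrite mem_cat x3 orbT /= x1 => /(_ erefl).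
have hN : theta' <= #|nbhds B :&: nbhds A|%:R.
  rewrite leNgt; apply: contra napair => h.
  apply/existsP; exists B; apply/existsP; exists A; rewrite cB eqxx typ // dAB.
  by rewrite subUset AO BO inE cA eqxx h.
exists ((nbhds B :&: nbhds A) :\: [set x in P]).
  rewrite -(leq_add2r (3 * L)) -(ler_nat R) natrD (le_trans zth) // (le_trans hN) //.
  rewrite ler_nat -(cardsID [set x in P] (nbhds B :&: nbhds A)) addnC leq_add2l.
  by rewrite -szP (leq_trans (subset_leq_card (subsetIr _ _))) // cardsE card_size.
move=> O' nc; rewrite -setI_eq0; apply/eqP/setP => v; rewrite [RHS]inE; apply/negP.
rewrite !inE => /andP[/and3P[vP vB vA] vO']; case/negP: nc; apply/asboolP.
rewrite PE in vP srt un.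
have [s [ss us cs sL]] := close_path srt un vP vA vB.
apply: (has_cycle_ge_induced _ us cs).
- move=> x /ss; rewrite !inE -PE => /orP[/eqP->|/sub->//].
  by rewrite vO' orbT.
- by apply: leq_trans sL; rewrite leq_addr.
- by rewrite ler_nat -sz2; apply: leq_trans sL; rewrite leq_addl.
Qed.

(** The five terms are the ways to fail: too few open answers, a poorly expanding set of size [s1]
    (no long stack), one of size [L], an atypical pair, and a second round that misses all of
    [Z]. *)
Lemma cycle_failure (x0 : G) (p1 p2 rho theta1 theta2 theta3 : R) t m s1 k1 L k z :
  let tau x := (x / n%:R - gamma) * d%:R in
  0 <= p1 <= 1 -> 0 <= p2 <= 1 -> 0 < rho <= 1 ->
  (t <= n)%N -> (s1 + 3 * L <= m)%N -> t%:R < theta1 ->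
  0 < tau (n%:R - theta1) -> theta1 <= (s1%:R - k1%:R) * tau (n%:R - theta1) ->
  0 < tau (n%:R - theta2) -> theta2 <= (L%:R - k%:R) * tau (n%:R - theta2) ->
  0 < tau (theta2 - theta3) -> theta3 <= (L%:R - k%:R) * tau (theta2 - theta3) ->
  (k <= L)%N -> z%:R + (3 * L)%:R <= theta3 ->
  subset_mean (1 - (1 - p1) * (1 - p2)) (fun O => (no_cycle L O)%:R) <=
    (1 - p1 + p1 * rho) ^+ t / rho ^+ m
    + (2 * n%:R * p1) ^+ s1 / (s1`!%:R * M ^+ k1)
    + (2 * n%:R * p1) ^+ L / (L`!%:R * M ^+ k)
    + (n%:R * p1) ^+ L / L`!%:R * ((2 * n%:R * p1) ^+ L / (L`!%:R * M ^+ k))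
    + (1 - p2) ^+ z.
Proof.
move=> tau p101 p201 r01 tn slm tth t1 h1 t2 h2 t3 h3 kL zth.
rewrite subset_mean_union.
pose F1 O : R := (#|dfs_open (site_dfs x0 O t)| < m)%N%:R.
pose F2 O : R := [exists A in atypical s1 setT theta1, A \subset O]%:R.
pose F3 O : R := [exists A in atypical L setT theta2, A \subset O]%:R.
pose F4 O : R := (atypical_pair L theta2 theta3 O)%:R.
have q20 : 0 <= (1 - p2) ^+ z by rewrite exprn_ge0 // subr_ge0; case/andP: p201.
apply: (@le_trans _ _ (subset_mean p1
    (fun O => F1 O + F2 O + F3 O + F4 O + (1 - p2) ^+ z * 1))); last first.
  rewrite !subset_meanD subset_meanZ subset_mean1 mulr1 lerD2r.
  rewrite !lerD //; [apply: mean_few_open => // | exact: mean_atypical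
                    | exact: mean_atypical | exact: mean_atypical_pair].
  by rewrite cardG.
apply: subset_mean_le => // O; rewrite mulr1.
have le1 : subset_mean p2 (fun O' => (no_cycle L (O :|: O'))%:R) <= 1.
  rewrite -[leRHS](subset_mean1 G p2); apply: subset_mean_le => // O'.
  by rewrite (ler_nat _ _ 1) leq_b1.
have [g1 g2 g3 g4] : [/\ 0 <= F1 O, 0 <= F2 O, 0 <= F3 O & 0 <= F4 O] by [].
have [f1|f1] := boolP (#|dfs_open (site_dfs x0 O t)| < m)%N.
  by have : F1 O = 1 by [rewrite /F1 f1]; lra.
have [f2|f2] := boolP [exists A in atypical s1 setT theta1, A \subset O].
  by have : F2 O = 1 by [rewrite /F2 f2]; lra.
have [f3|f3] := boolP [exists A in atypical L setT theta2, A \subset O].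
  by have : F3 O = 1 by [rewrite /F3 f3]; lra.
have [f4|f4] := boolP (atypical_pair L theta2 theta3 O).
  by have : F4 O = 1 by [rewrite /F4 f4]; lra.
rewrite -leqNgt in f1.
have typ s theta : ~~ [exists A in atypical s setT theta, A \subset O] ->
    forall A, #|A| = s -> A \subset O -> theta <= #|nbhds A|%:R.
  move=> f A As AO; rewrite leNgt; apply: contra f => h; apply/existsP; exists A.
  by rewrite AO inE As eqxx setTI h.
have [|P [un sub srt szP]] := dfs_long_path _ slm tth f1 (typ _ _ f2).
  by rewrite cardG.
have [Z zZ hZ] := sprinkled_cycle un sub srt szP (typ _ _ f3) f4 zth.
apply: (@le_trans _ _ ((1 - p2) ^+ z)); last by rewrite lerDr !addr_ge0.
apply: (@le_trans _ _ ((1 - p2) ^+ #|Z|)); last first.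
  by case/andP: p201 => a b; rewrite ler_wiXn2l //; lra.
rewrite -mean_disjoint; apply: subset_mean_le => // O'.
by rewrite ler_nat; case nc: (no_cycle _ _); rewrite // hZ.
Qed.
End Failure.

(** * Estimates *)

Section Estimates.
Variable R : realType.
Implicit Types (a c h p x y X : R) (k m n s t : nat).

Lemma expr1B_le_expR x n : x <= 1 -> (1 - x) ^+ n <= expR (- (x * n%:R)).
Proof.
move=> x1; rewrite -mulNr expRM_natr lerXn2r ?nnegrE ?expR_ge0 ?subr_ge0 //.
exact: expR_ge1Dx.
Qed.

Lemma expR1_le4 : expR 1 <= 4 :> R.
Proof.
have h : expR (2^-1) <= 2 :> R.
  have := expR_ge1Dx (- 2^-1 : R); rewrite expRN => h.
  rewrite -[leLHS]invrK invf_ple ?posrE ?invr_gt0 ?expR_gt0 //; lra.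
have -> : expR 1 = expR (2^-1) ^+ 2 :> R by rewrite -expRM_natl divff.
have := expR_gt0 (2^-1 : R); nra.
Qed.

(** Induction with [(1 + 1/s)^s <= e <= 4], a weak form of Stirling's bound. *)
Lemma expr_self_le_fact s : s%:R ^+ s <= 4 ^+ s * s`!%:R :> R.
Proof.
elim: s => [|s IH]; first by rewrite !expr0 mul1r.
case: (posnP s) => [->|s0]; first by rewrite !expr1 (_ : 1`! = 1%N) //; lra.
have sR : 0 < s%:R :> R by rewrite ltr0n.
have h : (s.+1%:R : R) ^+ s <= 4 * s%:R ^+ s.
  have -> : s.+1%:R = (1 + s%:R^-1) * s%:R :> R.
    by rewrite mulrDl mul1r mulVf ?gt_eqF // -natr1 addrC.
  rewrite exprMn ler_wpM2r ?exprn_ge0 ?(ltW sR) //.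
  apply: le_trans expR1_le4.
  have -> : expR 1 = expR s%:R^-1 ^+ s :> R by rewrite -expRM_natr mulVf ?gt_eqF.
  by rewrite lerXn2r ?nnegrE ?expR_ge0 ?expR_ge1Dx.
rewrite exprS factS natrM exprS.
have s1 : 0 <= s.+1%:R :> R by [].
nra.
Qed.

Lemma expr_le_fact a y s : 0 <= y -> 4 * y <= a * s%:R -> y ^+ s <= a ^+ s * s`!%:R.
Proof.
move=> y0 h; case: (posnP s) => [->|s0]; first by rewrite !expr0 mulr1.
have a0 : 0 <= a.
  rewrite -(pmulr_lge0 _ (_ : 0 < s%:R)) ?ltr0n //; apply: le_trans h; lra.
rewrite -(ler_pM2l (_ : 0 < 4 ^+ s)) ?exprn_gt0 // -exprMn.
apply: (@le_trans _ _ ((a * s%:R) ^+ s)).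
  by rewrite lerXn2r ?nnegrE ?mulr_ge0.
rewrite exprMn mulrCA ler_wpM2l ?exprn_ge0 //; exact: expr_self_le_fact.
Qed.

Lemma nat_floor x : 0 <= x -> exists k : nat, k%:R <= x < k%:R + 1.
Proof.
by move=> x0; exists (Num.truncn x); have := truncn_itv x0; rewrite -natr1.
Qed.

Lemma nat_ceil x : 0 <= x -> exists k : nat, x <= k%:R <= x + 1.
Proof.
move=> /nat_floor[k /andP[h1 h2]]; exists k.+1; rewrite -natr1; lra.
Qed.

(** The choice [rho = 1 / (1 + h)], with [1 - rho >= h (1 - h)] and [1 + h <= e^h]. *)
Lemma chernoff_lower h p t m :
  0 < h <= 1 -> 0 <= p <= 1 ->
  (1 - p + p * (1 + h)^-1) ^+ t / (1 + h)^-1 ^+ m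
    <= expR (h * m%:R - h * (1 - h) * (p * t%:R)).
Proof.
move=> /andP[h0 h1] /andP[p0 p1].
have u0 : 0 < 1 + h by lra.
have r1 : h * (1 - h) <= 1 - (1 + h)^-1.
  rewrite -(ler_pM2r u0) mulrBl mulVf ?gt_eqF //; nra.
have r0 : 0 < (1 + h)^-1 by rewrite invr_gt0.
set r := (1 + h)^-1 in r1 r0 *.
have e1 : (1 - p + p * r) ^+ t <= expR (- (h * (1 - h) * (p * t%:R))).
  rewrite (_ : 1 - p + p * r = 1 - p * (1 - r)); last by ring.
  apply: le_trans (expr1B_le_expR _ _) _; first by nra.
  rewrite ler_expR lerN2 (_ : p * (1 - r) * _ = (1 - r) * (p * t%:R)); last by ring.
  by rewrite ler_wpM2r ?mulr_ge0.
have e2 : (r ^+ m)^-1 <= expR (h * m%:R).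
  rewrite /r exprVn invrK expRM_natr lerXn2r ?nnegrE ?expR_ge0 ?(ltW u0) //.
  exact: expR_ge1Dx.
rewrite expRD mulrC ler_pM ?invr_ge0 ?exprn_ge0 ?(ltW r0) //; nra.
Qed.
End Estimates.

(** Discrepancy of the singleton [x0]: each of its [d] neighbours deviates by [1 - d/n >= 1/2]. *)
Lemma degree_lower_bound (R : realType) (n d : nat) (lambda : R) (G : sgraph) (x0 : G) :
  ndlambda_graph n d lambda G -> lambda < d%:R -> 2 * d%:R <= n%:R :> R ->
  d%:R <= 4 * lambda ^+ 2.
Proof.
move=> ndl ld dn; have := spectral_discrepancy [set x0] ndl ld.
have [cG reg _] := ndl.
have n0 : 0 < n%:R :> R by rewrite ltr0n -cG; apply/card_gt0P; exists x0.
rewrite cards1 !mulr1 => h.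
have c2 : d%:R / n%:R <= 2^-1 :> R by rewrite ler_pdivrMr //; lra.
suff : d%:R * 4^-1 <= \sum_(v : G) (#|nbhd v :&: [set x0]|%:R - d%:R / n%:R) ^+ 2 :> R.
  by move: h; set S := \sum_(v : G) _; lra.
rewrite (bigID (mem (nbhd x0))) /= -[leLHS]addr0 lerD ?sumr_ge0 // => [|v _]; last first.
  exact: sqr_ge0.
rewrite -{1}(card_nbhd x0 reg) mulr_natl -sumr_const; apply: ler_sum => v.
rewrite inE => xv; have -> : nbhd v :&: [set x0] = [set x0].
  by apply/setIidPr; rewrite sub1set inE adj_sym.
rewrite cards1; nra.
Qed.

(** * Numerical bounds for the failure terms *)

Section Numerics.
Variable R : realType.
Implicit Types (eps u y X : R) (s k N L : nat).

(** Here [y^s <= u^(4s) s!], while [M^k] with [M = u^N] is at least [u^(10s)]; the surplus is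
    [u^(6s)]. *)
Lemma atypical_term u y s k N :
  1 <= u -> 0 <= y -> 4 * y <= u ^+ 4 * s%:R -> (10 * s <= N * k)%N ->
  y ^+ s / (s`!%:R * (u ^+ N) ^+ k) <= (u ^+ (6 * s))^-1.
Proof.
move=> u1 y0 hy hk; have u0 : 0 < u by lra.
have f0 : 0 < s`!%:R :> R by rewrite ltr0n fact_gt0.
rewrite -exprM ler_pdivrMr ?mulr_gt0 ?exprn_gt0 // mulrC ler_pdivlMr ?exprn_gt0 //.
apply: (@le_trans _ _ ((u ^+ 4) ^+ s * s`!%:R * u ^+ (6 * s))).
  by rewrite ler_wpM2r ?exprn_ge0 ?(ltW u0) //; exact: expr_le_fact.
rewrite -exprM mulrAC -exprD mulrC ler_wpM2l ?(ltW f0) // ler_weXn2l //; lia.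
Qed.

Lemma inv_expr_le_expR u s : 4 <= u -> (u ^+ s)^-1 <= expR (- s%:R).
Proof.
move=> u4; rewrite expRN lef_pV2 ?posrE ?expR_gt0 ?exprn_gt0 //; last by lra.
rewrite -[s%:R]mul1r expRM_natr lerXn2r ?nnegrE ?expR_ge0 //; first lra.
exact: le_trans (expR1_le4 R) u4.
Qed.

(** From [N >= eps^-3] and [k >= eps s / 100] one gets [N k >= s / (100 eps^2)], well above
    [10 s]. *)
Lemma many_bad_positions eps s k N :
  0 < eps -> eps <= (10 ^+ 3)^-1 -> 1 <= eps ^+ 3 * N%:R -> eps * s%:R <= 100 * k%:R ->
  (10 * s <= N * k)%N.
Proof.
move=> e0 e1 hN hk; rewrite -(ler_nat R) !natrM.
have s0 : 0 <= s%:R :> R by []. have k0 : 0 <= k%:R :> R by [].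
have N0 : 0 <= N%:R :> R by [].
have h1 : s%:R <= 100 * eps ^+ 2 * (N%:R * k%:R).
  have h : eps * s%:R <= eps * (100 * eps ^+ 2 * (N%:R * k%:R)).
    apply: le_trans hk _.
    rewrite (_ : _ * _ = 100 * k%:R * (eps ^+ 3 * N%:R)); last by ring.
    rewrite ler_peMr // mulr_ge0 //.
  by rewrite ler_pM2l in h.
have : eps ^+ 2 <= (10 ^+ 3)^-1 by nra.
have : 0 <= N%:R * k%:R :> R by rewrite mulr_ge0.
set w := N%:R * k%:R in h1 *; nra.
Qed.

(** Half of the exponent absorbs the factor 5, because [e^(cX/2) >= 1 + cX/2 >= 5]. *)
Lemma sum_five_expR (c X : R) : 8 <= c * X ->
  5 * expR (- (c * X)) <= expR (- (c / 2 * X)).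
Proof.
move=> h; set F := expR (- (c / 2 * X)).
have -> : expR (- (c * X)) = F * F by rewrite -expRD; congr expR; field.
have F0 : 0 < F by apply: expR_gt0.
have : F * expR (c / 2 * X) = 1 by rewrite -expRD addNr expR0.
have := expR_ge1Dx (c / 2 * X); set E := expR _ => h1 h2.
have : 5 <= E by nra.
nra.
Qed.

(** The mean number of open answers is about [eps X / 4 + (9/40) eps^2 X], above [m] by
    [eps^2 X / 40]. The tilt [h = eps / 40] loses only [eps^2 X / 160] of this to the factor
    [1 - h]. *)
Lemma chernoff_term eps X (d t m : nat) (n : R) :
  0 < eps -> eps <= (10 ^+ 3)^-1 -> (0 < d)%N -> n = X * d%:R -> 200 <= eps ^+ 2 * X ->
  eps * n / 4 - 1 <= t%:R -> m%:R <= eps * X / 4 + eps ^+ 2 * X / 5 ->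
  let h := eps / 40 in let p1 := (1 + 9 / 10 * eps) / d%:R in
  0 <= p1 <= 1 ->
  (1 - p1 + p1 * (1 + h)^-1) ^+ t / (1 + h)^-1 ^+ m <= expR (- (eps ^+ 5 * X)).
Proof.
move=> e0 e1 d0 nE hX ht hm h p1 p101.
have hh : 0 < h <= 1 by rewrite /h; lra.
apply: le_trans (chernoff_lower _ _ hh p101) _; rewrite ler_expR.
have dR : 1 <= d%:R :> R by rewrite ler1n.
have hp : (1 + 9 / 10 * eps) * (eps * X / 4) - 2 <= p1 * t%:R.
  apply: (@le_trans _ _ (p1 * (eps * n / 4 - 1))); last first.
    by rewrite ler_wpM2l //; case/andP: p101.
  rewrite (_ : p1 * _ = (1 + 9 / 10 * eps) * (eps * X / 4) - p1); last first.
    by rewrite /p1 nE; field; lra.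
  by rewrite lerD2l lerN2; case/andP: p101; lra.
set q := p1 * t%:R in hp *.
have h0 : 0 < h by rewrite /h; lra.
(* Multiplied by [h], this gives [eps^3 X / 6400], which exceeds [eps^5 X] as [eps^2 <= 1/6400]. *)
suff : m%:R - (1 - h) * q <= - (eps ^+ 2 * X / 160).
  rewrite -(ler_pM2l h0) mulrBr mulrA => hs; apply: le_trans hs _.
  have : eps ^+ 2 <= (64 * 10 ^+ 2)^-1 by nra.
  have : 0 <= eps ^+ 3 * X by rewrite exprS -mulrA mulr_ge0 ?(ltW e0) //; lra.
  rewrite (_ : eps ^+ 5 * X = eps ^+ 2 * (eps ^+ 3 * X)); last by ring.
  rewrite (_ : h * _ = - ((64 * 10 ^+ 2)^-1 * (eps ^+ 3 * X))); last by rewrite /h; field.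
  nra.
have X0 : 0 <= eps * X by nra.
have hq : (1 - h) * ((1 + 9 / 10 * eps) * (eps * X / 4) - 2) <= (1 - h) * q.
  by rewrite ler_wpM2l // /h; lra.
have : 0 <= eps ^+ 2 * X by lra.
have : eps ^+ 2 * X <= (10 ^+ 3)^-1 * (eps * X) by rewrite expr2 -mulrA; nra.
have : eps * (eps ^+ 2 * X) <= (10 ^+ 3)^-1 * (eps ^+ 2 * X) by nra.
move: hq; rewrite /h.
rewrite (_ : (1 - eps / 40) * ((1 + 9 / 10 * eps) * (eps * X / 4) - 2) =
  eps * X / 4 + 9 / 40 * (eps ^+ 2 * X) - eps ^+ 2 * X / 160
  - 9 / (16 * 10 ^+ 2) * (eps * (eps ^+ 2 * X)) - 2 + eps / 20); last by field.
lra.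
Qed.
End Numerics.

Lemma leq_six_mul (N : nat) : (1 < N)%N -> (6 + N <= 6 * N)%N.
Proof. by lia. Qed.

(** Compares the monomials in [eps] and [X] once, so that later estimates are linear in them. *)
Lemma scale_bounds (R : realType) (eps X : R) :
  0 < eps -> eps <= (10 ^+ 3)^-1 -> 8 <= eps ^+ 8 * X ->
  [/\ 10 ^+ 6 <= eps ^+ 2 * X, eps ^+ 2 * X <= (10 ^+ 3)^-1 * (eps * X),
      eps * X <= (10 ^+ 3)^-1 * X & eps * (eps ^+ 2 * X) <= (10 ^+ 3)^-1 * (eps ^+ 2 * X)].
Proof.
move=> e0 e1 hX.
have X0 : 0 <= X by rewrite -(pmulr_rge0 _ (exprn_gt0 8 e0)); lra.
have a0 : 0 <= eps * X by rewrite mulr_ge0 ?(ltW e0).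
have b0 : 0 <= eps ^+ 2 * X by rewrite mulr_ge0 ?exprn_ge0 ?(ltW e0).
have h2 : eps ^+ 2 <= (10 ^+ 6)^-1.
  have -> : (10 ^+ 6)^-1 = (10 ^+ 3)^-1 * (10 ^+ 3)^-1 :> R by rewrite -invfM -exprD.
  by rewrite expr2 ler_pM ?(ltW e0).
have h6 : eps ^+ 6 <= (10 ^+ 6)^-1.
  apply: le_trans h2; rewrite ler_wiXn2l ?(ltW e0) //; lra.
split; [|by rewrite expr2 -mulrA ler_wpM2r|by rewrite ler_wpM2r|by rewrite ler_wpM2r].
rewrite -[leLHS]mulr1 -ler_pdivlMl; last by lra.
apply: (@le_trans _ _ (eps ^+ 6 * (eps ^+ 2 * X))); last by rewrite ler_wpM2r.
by rewrite mulrA -exprD; lra.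
Qed.

(** * Parameter conditions for expansion and sprinkling *)

Section Conditions.
Variable R : realType.

(** [theta] must exceed the [eps n / 4] queries. The surplus [14/100] of [eps^2 X] in [s] pays for
    overlapping neighbourhoods (about [1/16]) and the [k] poor positions (about [1/400]), leaving
    more than the required [1/100]. *)
Lemma typical_cond_dfs (eps X D n s k : R) :
  0 < eps -> eps <= (10 ^+ 3)^-1 -> 8 <= eps ^+ 8 * X -> 0 < D -> n = X * D ->
  eps * X / 4 + 14 / 100 * (eps ^+ 2 * X) - 1 <= s -> k <= eps * s / 100 + 1 ->
  let theta := (eps * X / 4 + eps ^+ 2 * X / 100) * D in
  let tau := ((n - theta) / n - eps ^+ 3) * D in
  0 < tau /\ theta <= (s - k) * tau.
Proof.
move=> e0 e1 hX D0 nE hs hk theta tau.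
have [b0 ba aX eb] := scale_bounds e0 e1 hX.
have X0 : 0 < X by lra.
pose w := 1 - eps / 4 - eps ^+ 2 / 100 - eps ^+ 3.
have tauE : tau = w * D by rewrite /tau /theta /w nE; field; rewrite !gt_eqF.
have e2 : eps ^+ 2 <= (10 ^+ 3)^-1 * eps by rewrite expr2 ler_wpM2r ?(ltW e0).
have e3 : eps ^+ 3 <= (10 ^+ 3)^-1 * eps by rewrite exprSr ler_wpM2r ?(ltW e0) //; nra.
have w0 : 1 - 26 / 100 * eps <= w by rewrite /w; lra.
have wp : 0 < 1 - 26 / 100 * eps by lra.
rewrite tauE; split; first by rewrite mulr_gt0 //; lra.
rewrite mulrA /theta ler_wpM2r ?(ltW D0) //.
pose a := eps * X; pose b := eps ^+ 2 * X.
have ab : eps * a = b by rewrite /a /b; ring.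
have q0 : a / 4 + 13 / 100 * b - 2 <= s - k.
  have : (a / 4 + 14 / 100 * b - 1) * (1 - eps / 100) <= s * (1 - eps / 100).
    by rewrite ler_wpM2r //; lra.
  rewrite (_ : (a / 4 + _ - 1) * _ = a / 4 + 14 / 100 * b - 1 - (eps * a) / 400
     - 14 / 10 ^+ 4 * (eps * b) + eps / 100); last by field.
  rewrite ab; move: b0 eb; rewrite -/b; lra.
have hq : (a / 4 + 13 / 100 * b - 2) * (1 - 26 / 100 * eps) <= (s - k) * w.
  apply: ler_pM => //; first by move: b0 ba; rewrite -/a -/b; lra.
  exact: ltW wp.
apply: le_trans hq.
rewrite (_ : (a / 4 + _ - 2) * _ = a / 4 + 13 / 100 * b - 2 - 65 / 10 ^+ 3 * (eps * a)
     - 13 * 26 / 10 ^+ 4 * (eps * b) + 52 / 100 * eps); last by field.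
rewrite ab; move: b0 eb; rewrite -/a -/b; lra.
Qed.

(** With [r = l / X], an [l]-set should reach half of [D l] vertices, a fraction [r / 2] of the
    graph; a second set then meets about that fraction of its own [D l] neighbours. The slack
    [eps^3] is at most [r / 10], so [r / 16] is safe. *)
Lemma typical_cond_path (eps X D n l k : R) :
  0 < eps -> eps <= (10 ^+ 3)^-1 -> 8 <= eps ^+ 8 * X -> 0 < D -> n = X * D ->
  eps ^+ 2 * X / 100 <= l -> l <= eps ^+ 2 * X / 100 + 1 -> k <= eps * l / 100 + 1 ->
  let theta2 := D * l / 2 in let theta3 := D * l * (l / X) / 16 in
  let tau x := (x / n - eps ^+ 3) * D in
  [/\ 0 < tau (n - theta2), theta2 <= (l - k) * tau (n - theta2),
      0 < tau (theta2 - theta3) & theta3 <= (l - k) * tau (theta2 - theta3)].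
Proof.
move=> e0 e1 hX D0 nE hl1 hl2 hk theta2 theta3 tau.
have [b0 ba aX eb] := scale_bounds e0 e1 hX.
have X0 : 0 < X by lra.
have l0 : 0 < l by lra.
pose r := l / X.
have r1 : eps ^+ 2 / 100 <= r by rewrite /r ler_pdivlMr // mulrAC.
have r2 : r <= (10 ^+ 3)^-1 by rewrite /r ler_pdivrMr //; lra.
have r0 : 0 < r by rewrite /r divr_gt0.
have e2 : eps ^+ 2 <= (10 ^+ 3)^-1 * eps by rewrite expr2 ler_wpM2r ?(ltW e0).
have e3 : eps ^+ 3 <= (10 ^+ 3)^-1 * eps ^+ 2 by rewrite exprS ler_wpM2r ?exprn_ge0 ?(ltW e0).
have tau2E : tau (n - theta2) = (1 - r / 2 - eps ^+ 3) * D.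
  by rewrite /tau /theta2 /r nE; field; rewrite !gt_eqF.
have tau3E : tau (theta2 - theta3) = (r / 2 - r * r / 16 - eps ^+ 3) * D.
  by rewrite /tau /theta2 /theta3 /r nE; field; rewrite !gt_eqF.
have lk : 9 / 10 * l <= l - k.
  have : eps * l <= (10 ^+ 3)^-1 * l by rewrite ler_wpM2r ?(ltW l0).
  lra.
have w2 : 9 / 10 <= 1 - r / 2 - eps ^+ 3 by lra.
have w3 : r / 4 <= r / 2 - r * r / 16 - eps ^+ 3.
  have : r * r <= (10 ^+ 3)^-1 * r by rewrite ler_wpM2r ?(ltW r0).
  lra.
rewrite tau2E tau3E; split.
- by rewrite mulr_gt0 //; lra.
- rewrite mulrA /theta2 -mulrA mulrC ler_wpM2r ?(ltW D0) //.
  have : (9 / 10 * l) * (9 / 10) <= (l - k) * (1 - r / 2 - eps ^+ 3).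
    by rewrite ler_pM //; lra.
  lra.
- by rewrite mulr_gt0 //; lra.
- rewrite mulrA /theta3 -/r (_ : D * l * r / 16 = (l * r / 16) * D); last by field.
  rewrite ler_wpM2r ?(ltW D0) //.
  have : (9 / 10 * l) * (r / 4) <= (l - k) * (r / 2 - r * r / 16 - eps ^+ 3).
    by rewrite ler_pM //; lra.
  have : 0 <= l * r by rewrite mulr_ge0 ?(ltW l0) ?(ltW r0).
  lra.
Qed.

(** As [D l / X >= 96], half of the common neighbourhood has room for the [3 l] path vertices and
    the other half gives [z]. The expected number of hits is then of order [eps^5 X], with a
    constant beaten by [eps^3 <= 10^-9]. *)
Lemma sprinkle_cond (eps X D l z : R) :
  0 < eps -> eps <= (10 ^+ 3)^-1 -> 8 <= eps ^+ 8 * X -> 0 < D -> 96 * 100 <= eps ^+ 2 * D ->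
  eps ^+ 2 * X / 100 <= l -> z <= D * l * (l / X) / 32 < z + 1 ->
  z + 3 * l <= D * l * (l / X) / 16 /\ eps ^+ 8 * X <= eps / (10 * D) * z.
Proof.
move=> e0 e1 hX D0 hD hl /andP[z1 z2].
have [b0 ba aX eb] := scale_bounds e0 e1 hX.
have X0 : 0 < X by lra.
have l0 : 0 < l by lra.
pose r := l / X.
have r1 : eps ^+ 2 / 100 <= r by rewrite /r ler_pdivlMr // mulrAC.
have r0 : 0 < r by rewrite /r divr_gt0.
have Dr : 96 <= D * r.
  apply: (@le_trans _ _ (D * (eps ^+ 2 / 100))); first lra.
  by rewrite ler_wpM2l ?(ltW D0).
rewrite -/r in z1 z2 *.
have lDr : 96 * l <= D * l * r by rewrite (mulrAC D) ler_wpM2r ?(ltW l0).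
split; first lra.
have z3 : D * l * r / 64 <= z by lra.
apply: (@le_trans _ _ (eps / (10 * D) * (D * l * r / 64))); last first.
  by rewrite ler_wpM2l // divr_ge0 ?(ltW e0) // mulr_ge0 ?(ltW D0).
rewrite (_ : _ * (D * l * r / 64) = eps / (64 * 10) * (l * r)); last by field; rewrite gt_eqF.
apply: (@le_trans _ _ (eps / (64 * 10) * ((eps ^+ 2 * X / 100) * (eps ^+ 2 / 100)))); last first.
  rewrite ler_wpM2l ?divr_ge0 ?(ltW e0) // ler_pM ?divr_ge0 ?exprn_ge0 ?(ltW e0) //; lra.
rewrite (_ : eps / (64 * 10) * _ = (64 * 10 ^+ 5)^-1 * (eps ^+ 5 * X)); last by field.
rewrite (_ : eps ^+ 8 * X = eps ^+ 3 * (eps ^+ 5 * X)); last by ring.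
rewrite ler_wpM2r //; first by rewrite mulr_ge0 ?exprn_ge0 ?(ltW e0) ?(ltW X0).
have : eps ^+ 3 <= (10 ^+ 3)^-1 * ((10 ^+ 3)^-1 * (10 ^+ 3)^-1).
  by rewrite (_ : eps ^+ 3 = eps * (eps * eps)) ?ler_pM ?mulr_ge0 ?(ltW e0) //; ring.
lra.
Qed.
End Conditions.

(** * Choice of parameters, with [gamma = eps^3] and [M = eps^-N] *)

Section Core.
Variables (R : realType) (eps X : R) (G : sgraph) (n d N L : nat) (lambda : R).
Hypotheses (e0 : 0 < eps) (e1 : eps <= (10 ^+ 3)^-1).
Hypothesis d0 : (0 < d)%N.
Hypothesis nE : n%:R = X * d%:R.
Hypothesis hX : 8 <= eps ^+ 8 * X.
Hypothesis ndl : ndlambda_graph n d lambda G.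
Hypothesis hN : 1 <= eps ^+ 3 * N%:R.
Hypothesis hl : lambda <= eps ^+ (3 * N) * d%:R.
Hypothesis hL : eps ^+ 2 * X / 100 <= L%:R <= eps ^+ 2 * X / 100 + 1.

Lemma eps_le1 : eps <= 1. Proof. by have := e1; lra. Qed.
Lemma scale_gt0 : 0 < X. Proof. by have [] := scale_bounds e0 e1 hX; lra. Qed.
Lemma degree_gt0 : 0 < d%:R :> R. Proof. by rewrite ltr0n. Qed.
Lemma order_gt0 : 0 < n%:R :> R.
Proof. by rewrite nE mulr_gt0 ?scale_gt0 ?degree_gt0. Qed.

Lemma exponent_gt1 : (2 <= N)%N.
Proof.
rewrite ltnNge; apply/negP => N1; move: hN; apply/negP; rewrite -ltNge.
have : N%:R <= 1 :> R by rewrite (ler_nat _ _ 1).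
have : 0 <= N%:R :> R by [].
have : eps ^+ 3 <= (10 ^+ 3)^-1.
  apply: le_trans e1; rewrite -[leRHS]expr1 ler_wiXn2l ?(ltW e0) //; exact: eps_le1.
have : 0 < eps ^+ 3 by apply: exprn_gt0.
nra.
Qed.

Lemma lambda_ge0 : 0 <= lambda.
Proof. by case: ndl => _ _ [ev [_ _ ->]]; rewrite le_max normr_ge0. Qed.

Lemma lambda_lt : lambda < d%:R.
Proof.
apply: le_lt_trans hl _; rewrite gtr_pMl ?degree_gt0 //.
by rewrite exprn_ilt1 ?(ltW e0) //; [rewrite muln_eq0 /= -lt0n ltnW ?exponent_gt1 | have := e1; lra].
Qed.

Lemma lambda_sq : lambda ^+ 2 <= eps ^+ (6 * N) * d%:R ^+ 2.
Proof.
have -> : eps ^+ (6 * N) * d%:R ^+ 2 = (eps ^+ (3 * N) * d%:R) ^+ 2.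
  by rewrite exprMn -exprM; rewrite mulnAC.
by rewrite lerXn2r ?nnegrE ?lambda_ge0 // mulr_ge0 ?exprn_ge0 ?(ltW e0).
Qed.

(** Poor vertices number at most [lambda^2 n / (eps^3 d)^2 <= eps^(6N - 6) n], and [6 N - 6 >= N]
    for [N >= 2]. *)
Lemma poor_vertices_few (Z : {set G}) :
  eps^-1 ^+ N * #|poor_vertices n d (eps ^+ 3) Z|%:R <= n%:R.
Proof.
have := card_poor_vertices Z ndl lambda_lt (exprn_ge0 3 (ltW e0)).
set c : R := _%:R => h.
have d2 : 0 < d%:R ^+ 2 :> R by rewrite exprn_gt0 ?degree_gt0.
have e6 : 0 < eps ^+ 6 by apply: exprn_gt0.
have h1 : c * eps ^+ 6 <= eps ^+ (6 * N) * n%:R.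
  rewrite -(ler_pM2r d2); apply: (@le_trans _ _ (lambda ^+ 2 * n%:R)).
    by rewrite (_ : c * _ * _ = c * (eps ^+ 3 * d%:R) ^+ 2) //; ring.
  by rewrite [leRHS]mulrAC ler_wpM2r ?lambda_sq.
have h2 : eps ^+ (6 * N) <= eps ^+ 6 * eps ^+ N.
  by rewrite -exprD ler_wiXn2l ?(ltW e0) ?eps_le1 //; exact: leq_six_mul exponent_gt1.
rewrite exprVn ler_pdivrMl ?exprn_gt0 // -(ler_pM2r e6).
by apply: le_trans h1 _; rewrite [leRHS]mulrAC ler_wpM2r ?(ltW order_gt0) // mulrC.
Qed.

(** From [d <= 4 lambda^2 <= 4 eps^(6N) d^2] the degree is at least [eps^(-6N) / 4]. The constant is
    the one that sprinkling requires. *)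
Lemma degree_large (x0 : G) : 96 * 100 <= eps ^+ 2 * d%:R.
Proof.
have := degree_lower_bound x0 ndl lambda_lt; rewrite nE.
have : 2 * d%:R <= X * d%:R :> R by rewrite ler_wpM2r //; have [] := scale_bounds e0 e1 hX; lra.
move=> h /(_ h) {}h.
have h1 : 1 <= 4 * eps ^+ (6 * N) * d%:R.
  rewrite -(ler_pM2r degree_gt0) mul1r; apply: le_trans h _.
  by have := lambda_sq; rewrite expr2; nra.
have h2 : eps ^+ (6 * N) <= eps ^+ 2 * eps ^+ 4.
  by rewrite -exprD ler_wiXn2l ?(ltW e0) ?eps_le1 // leq_pmulr // ltnW ?exponent_gt1.
have h3 : eps ^+ 4 <= (10 ^+ 3)^-1 * ((10 ^+ 3)^-1 * (10 ^+ 3)^-1).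
  apply: (@le_trans _ _ (eps ^+ 3)); first by rewrite ler_wiXn2l ?(ltW e0) ?eps_le1.
  by rewrite (_ : eps ^+ 3 = eps * (eps * eps)) ?ler_pM ?mulr_ge0 ?(ltW e0) //; ring.
have h4 : 0 <= eps ^+ 2 * d%:R by rewrite mulr_ge0 ?exprn_ge0 ?(ltW e0).
have h5 : 1 <= 4 * eps ^+ 4 * (eps ^+ 2 * d%:R).
  apply: le_trans h1 _; rewrite (_ : 4 * eps ^+ 4 * _ = 4 * (eps ^+ 2 * eps ^+ 4) * d%:R).
    by rewrite ler_wpM2r // ler_wpM2l.
  by ring.
nra.
Qed.

Lemma percolation_no_cycle (x0 : G) :
  subset_mean ((1 + eps) / d%:R) (fun O : {set G} => (no_cycle R L O)%:R)
    <= expR (- (eps ^+ 8 / 2 * X)).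
Proof.
have [b0 ba aX eb] := scale_bounds e0 e1 hX.
have X0 := scale_gt0; have D0 := degree_gt0; have N0 := order_gt0.
have f0 := e0; have f1 := e1; have hD := degree_large x0.
have [l1 l2] := andP hL.
set D : R := d%:R in D0 hD *.
have D1 : 10 ^+ 3 <= D.
  have : eps ^+ 2 * D <= 1 * D by rewrite ler_wpM2r ?(ltW D0) // exprn_ile1 ?(ltW e0) ?eps_le1.
  lra.
have [t /andP[t1 t2]] : exists t : nat, t%:R <= eps * n%:R / 4 < t%:R + 1.
  by apply: nat_floor; rewrite divr_ge0 ?mulr_ge0 ?(ltW e0).
have [m /andP[m1 m2]] : exists m : nat,
    m%:R <= eps * X / 4 + eps ^+ 2 * X / 5 < m%:R + 1 by apply: nat_floor; lra.
have [s1 /andP[s11 s12]] : exists s1 : nat,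
    s1%:R <= eps * X / 4 + 14 / 100 * (eps ^+ 2 * X) < s1%:R + 1 by apply: nat_floor; lra.
have [k1 /andP[k11 k12]] : exists k1 : nat,
    eps * s1%:R / 100 <= k1%:R <= eps * s1%:R / 100 + 1.
  by apply: nat_ceil; rewrite divr_ge0 ?mulr_ge0 ?(ltW e0).
have [k /andP[k21 k22]] : exists k : nat, eps * L%:R / 100 <= k%:R <= eps * L%:R / 100 + 1.
  by apply: nat_ceil; rewrite divr_ge0 ?mulr_ge0 ?(ltW e0).
have [z z12] : exists z : nat, z%:R <= D * L%:R * (L%:R / X) / 32 < z%:R + 1.
  apply: nat_floor; rewrite divr_ge0 // mulr_ge0 ?divr_ge0 ?mulr_ge0 ?(ltW D0) ?(ltW X0) //.
(* [p2] solves [(1 - p1) (1 - p2) = 1 - (1 + eps) / D], so the union of the rounds has the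
   prescribed density. *)
pose p1 := (1 + 9 / 10 * eps) / D.
pose p2 := (eps / (10 * D)) / (1 - p1).
have p1lt : p1 < 1 by rewrite /p1 ltr_pdivrMr //; lra.
have p1ge : 0 <= p1 by rewrite /p1 divr_ge0 ?(ltW D0) //; lra.
have q1 : 0 < 1 - p1 by lra.
have c0 : 0 <= eps / (10 * D) by rewrite divr_ge0 ?(ltW e0) // mulr_ge0 ?(ltW D0).
have p2ge : eps / (10 * D) <= p2.
  by rewrite /p2 ler_pdivlMr // ler_piMr //; lra.
have p2le : p2 <= 1.
  rewrite /p2 ler_pdivrMr // mul1r lerBrDr /p1.
  have -> : eps / (10 * D) + (1 + 9 / 10 * eps) / D = (1 + eps) / D.
    by field; rewrite gt_eqF.
  by rewrite ler_pdivrMr //; lra.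
have pE : (1 + eps) / D = 1 - (1 - p1) * (1 - p2).
  rewrite /p2; have -> : (1 - p1) * (1 - eps / (10 * D) / (1 - p1)) = 1 - p1 - eps / (10 * D).
    by rewrite mulrBr mulr1 mulrCA divff ?mulr1 // gt_eqF.
  by rewrite /p1; field; rewrite gt_eqF.
have s13 : eps * X / 4 + 14 / 100 * (eps ^+ 2 * X) - 1 <= s1%:R by lra.
have [zL zX] := sprinkle_cond f0 f1 hX D0 hD l1 z12.
have cardG : #|G| = n by case: ndl.
have u1 : 10 ^+ 3 <= eps^-1 by rewrite -[leLHS]invrK lef_pV2 ?posrE ?invr_gt0 ?exprn_gt0.
have u1' : 1 <= eps^-1 by apply: le_trans u1; lra.
have M1 : 1 <= eps^-1 ^+ N by apply: exprn_ege1.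
have cX : eps ^+ 8 * X <= (10 ^+ 3)^-1 * (eps ^+ 2 * X).
  rewrite (_ : eps ^+ 8 * X = eps ^+ 6 * (eps ^+ 2 * X)); last by ring.
  rewrite ler_wpM2r //; first by lra.
  apply: le_trans f1; rewrite -[leRHS]expr1 ler_wiXn2l ?(ltW e0) ?eps_le1 //.
have r01 : 0 < (1 + eps / 40)^-1 <= 1.
  by rewrite invr_gt0 invf_le1; [apply/andP; split; lra | lra].
have tn : (t <= n)%N.
  rewrite -(ler_nat R) (le_trans t1) //.
  have : eps * n%:R <= 1 * n%:R by rewrite ler_wpM2r ?eps_le1.
  lra.
have slm : (s1 + 3 * L <= m)%N by rewrite -(ler_nat R) natrD natrM; lra.
have tth : t%:R < (eps * X / 4 + eps ^+ 2 * X / 100) * D.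
  apply: le_lt_trans t1 _; rewrite nE -/D.
  have : 0 < eps ^+ 2 * X / 100 * D by rewrite mulr_gt0 //; lra.
  lra.
have kL : (k <= L)%N.
  rewrite -(ler_nat R); apply: le_trans k22 _.
  have : eps * L%:R <= (10 ^+ 3)^-1 * L%:R by rewrite ler_wpM2r.
  lra.
have zL' : z%:R + (3 * L)%:R <= D * L%:R * (L%:R / X) / 16 by rewrite natrM.
have p101 : 0 <= p1 <= 1 by rewrite p1ge ltW.
have p201 : 0 <= p2 <= 1 by rewrite p2le (le_trans c0).
have [tau1 exp1] := typical_cond_dfs f0 f1 hX D0 nE s13 k12.
have [tau2 exp2 tau3 exp3] := typical_cond_path f0 f1 hX D0 nE l1 l2 k22.
rewrite pE.
have := cycle_failure M1 poor_vertices_few cardG x0 p101 p201 r01 tn slm tth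
  tau1 exp1 tau2 exp2 tau3 exp3 kL zL'.
move=> /le_trans; apply.
clear tau1 exp1 tau2 exp2 tau3 exp3 tn m2 s12 k12 k22 z12 pE slm tth kL zL zL'.
apply: le_trans (sum_five_expR hX).
set E := expR (- (eps ^+ 8 * X)).
have T1 : (1 - p1 + p1 * (1 + eps / 40)^-1) ^+ t / (1 + eps / 40)^-1 ^+ m <= E.
  apply: le_trans (chernoff_term f0 f1 d0 nE _ _ m1 p101) _; first lra; first lra.
  rewrite ler_expR lerN2 (_ : eps ^+ 8 * X = eps ^+ 3 * (eps ^+ 5 * X)); last by ring.
  rewrite ler_piMl ?mulr_ge0 ?exprn_ge0 ?(ltW e0) ?(ltW X0) //.
  by rewrite exprn_ile1 ?(ltW e0) ?eps_le1.
have nD : n%:R * p1 = (1 + 9 / 10 * eps) * X.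
  by rewrite nE /p1 -/D; field; rewrite gt_eqF.
have nD2 : n%:R * p1 <= 2 * X by rewrite nD; nra.
have np0 : 0 <= n%:R * p1 by rewrite mulr_ge0.
have u4 (s : nat) : eps ^+ 2 * X / 100 <= s%:R -> 16 * X <= eps^-1 ^+ 4 * s%:R.
  move=> hs; apply: (@le_trans _ _ (eps^-1 ^+ 4 * (eps ^+ 2 * X / 100))); last first.
    by rewrite ler_wpM2l ?exprn_ge0 // invr_ge0 ltW.
  rewrite (_ : _ * _ = eps^-1 * eps^-1 * X / 100); last by field; rewrite gt_eqF.
  have : 10 ^+ 3 * 10 ^+ 3 * X <= eps^-1 * eps^-1 * X.
    by rewrite ler_wpM2r ?(ltW X0) // ler_pM ?exprn_ge0.
  lra.
have term (s k' : nat) : eps ^+ 2 * X / 100 <= s%:R -> eps * s%:R / 100 <= k'%:R ->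
    (2 * n%:R * p1) ^+ s / (s`!%:R * (eps^-1 ^+ N) ^+ k') <= (eps^-1 ^+ (6 * s))^-1.
  move=> hs hk; apply: atypical_term => //.
  - by rewrite -mulrA mulr_ge0.
  - by apply: le_trans (u4 _ hs); rewrite -mulrA; lra.
  - by apply: (many_bad_positions f0 f1 hN); lra.
have small (s j : nat) : eps ^+ 2 * X / 100 <= s%:R -> (s <= j)%N ->
    (eps^-1 ^+ j)^-1 <= E.
  move=> hs sj; apply: (@le_trans _ _ (expR (- j%:R))).
    by apply: inv_expr_le_expR; apply: le_trans u1; lra.
  rewrite ler_expR lerN2; have : s%:R <= j%:R :> R by rewrite ler_nat.
  lra.
have T2 : (2 * n%:R * p1) ^+ s1 / (s1`!%:R * (eps^-1 ^+ N) ^+ k1) <= E.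
  have h : eps ^+ 2 * X / 100 <= s1%:R by lra.
  by apply: le_trans (term _ _ h k11) (small s1 _ h _); rewrite leq_pmull.
have T3' := term _ _ l1 k21.
have T3 : (2 * n%:R * p1) ^+ L / (L`!%:R * (eps^-1 ^+ N) ^+ k) <= E.
  by apply: le_trans T3' (small L _ l1 _); rewrite leq_pmull.
(* Choosing [B] costs at most [eps^(-4L)]; the gain [eps^(6L)] from [A] leaves [eps^(2L)]. *)
have T4 : (n%:R * p1) ^+ L / L`!%:R *
    ((2 * n%:R * p1) ^+ L / (L`!%:R * (eps^-1 ^+ N) ^+ k)) <= E.
  apply: le_trans (small L (2 * L)%N l1 _); last by rewrite leq_pmull.
  have fL : 0 < L`!%:R :> R by rewrite ltr0n fact_gt0.
  have up (j : nat) : 0 < eps^-1 ^+ j by rewrite exprn_gt0 // invr_gt0.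
  apply: (@le_trans _ _ (eps^-1 ^+ (4 * L) * (eps^-1 ^+ (6 * L))^-1)).
    apply: ler_pM => //.
    - by rewrite divr_ge0 ?exprn_ge0.
    - apply: divr_ge0; first by rewrite exprn_ge0 // -mulrA mulr_ge0.
      by rewrite mulr_ge0 ?(ltW fL) // exprn_ge0 // ltW.
    rewrite ler_pdivrMr // exprM; apply: expr_le_fact => //.
    by apply: le_trans (u4 _ l1); lra.
  by rewrite ler_pdivrMr // mulrC ler_pdivlMr // -exprD -mulnDl.
have T5 : (1 - p2) ^+ z <= E.
  apply: le_trans (expr1B_le_expR _ p2le) _; rewrite ler_expR lerN2.
  by apply: le_trans zX _; rewrite ler_wpM2r.
rewrite -/D in T1 *; lra.
Qed.
End Core.

(** * From the no-cycle bound to the theorem *)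

Lemma random_subset_prob_complement (R : realType) (T : finType) (p : R)
    (Q : {set T} -> Prop) :
  random_subset_prob p Q = 1 - subset_mean p (fun S => (~~ `[< Q S >])%:R).
Proof.
apply/eqP; rewrite eq_sym subr_eq -[X in X == _](subset_mean1 T p); apply/eqP.
rewrite /random_subset_prob [X in _ = X + _]big_mkcond -big_split; apply: eq_bigr => S _ /=.
by rewrite /subset_weight; case: `[< _ >] => /=; rewrite ?mulr0 ?mulr1 ?addr0 ?add0r.
Qed.

(** For a base at most 1 a larger exponent gives a smaller power, and [2 / alpha >= 2 / eps^3 >= N];
    then [alpha^N <= eps^(3N)]. *)
Lemma powR_ratio_le (R : realType) (eps alpha : R) (N : nat) :
  0 < alpha -> alpha < eps ^+ 3 -> eps <= 1 -> 0 < eps -> N%:R <= 2 / eps ^+ 3 ->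
  alpha `^ (2 / alpha) <= eps ^+ (3 * N).
Proof.
move=> a0 ae e1 e0 hN; have e30 : 0 < eps ^+ 3 by apply: exprn_gt0.
have a1 : alpha <= 1.
  by apply: le_trans (ltW ae) _; rewrite exprn_ile1 ?(ltW e0).
apply: (@le_trans _ _ (alpha `^ N%:R)).
  apply: ger_powR; first by rewrite a0.
  apply: le_trans hN _; rewrite ler_pM2l // lef_pV2 ?posrE //; exact: ltW.
rewrite powR_mulrn ?(ltW a0) // exprM lerXn2r ?nnegrE ?(ltW a0) ?(ltW e30) //.
exact: ltW.
Qed.

Local Open Scope classical_set_scope.

Theorem theorem5 (R : realType) :
  exists eps0 : R, 0 < eps0 /\
  forall eps : R, 0 < eps -> eps < eps0 ->
  exists beta : R, 0 < beta /\
  forall d : nat -> nat,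
    (forall n, (3 <= d n)%N) ->
    (fun n => (d n)%:R : R^o) =o_\oo (fun n => n%:R : R^o) ->
  \forall n \near \oo,
  forall (alpha lambda : R) (G : sgraph),
    2 * Num.sqrt ((d n)%:R / n%:R) < alpha ->
    alpha < eps ^+ 3 ->
    ndlambda_graph n (d n) lambda G ->
    lambda / (d n)%:R <= alpha `^ (2 / alpha) ->
  1 - expR (- (beta * (alpha ^+ 2 * n%:R / (d n)%:R))) <=
  random_subset_prob ((1 + eps) / (d n)%:R)
    (fun Vp : {set G} =>
       has_cycle_ge (induced_subgraph Vp) (eps ^+ 2 * n%:R / (10 ^+ 2 * (d n)%:R))).
Proof.
exists (10 ^+ 3)^-1; split; first by rewrite invr_gt0 exprn_gt0.
move=> eps e0 /ltW e1; exists (eps ^+ 8 / 2); split; first by rewrite divr_gt0 ?exprn_gt0.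
move=> d d3 /eqoP dn.
(* The hypothesis [d = o(n)] is used with this constant, which turns into [8 <= eps^8 X] for
   [X = n / d]. *)
have e80 : 0 < eps ^+ 8 / 8 by rewrite divr_gt0 ?exprn_gt0.
near=> n.
have hdn : (d n)%:R <= eps ^+ 8 / 8 * n%:R.
  have : `|(d n)%:R : R^o| <= eps ^+ 8 / 8 * `|n%:R : R^o| by near: n; apply: dn.
  by rewrite !ger0_norm.
move=> alpha lambda G ha1 ha2 ndl hl.
have D0 : 0 < (d n)%:R :> R by rewrite ltr0n; apply: leq_trans (d3 n).
have N0 : 0 < n%:R :> R.
  by rewrite -(pmulr_rgt0 _ e80); apply: lt_le_trans hdn.
have cG : #|G| = n by case: ndl.
have [x0 _] : exists x0 : G, x0 \in G.
  by apply/card_gt0P; rewrite cG -(ltr0n R).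
pose X : R := n%:R / (d n)%:R.
have nE : n%:R = X * (d n)%:R by rewrite /X divfK ?gt_eqF.
have hX : 8 <= eps ^+ 8 * X by rewrite /X mulrA ler_pdivlMr //; lra.
have X0 : 0 < X by rewrite /X divr_gt0.
have a0 : 0 < alpha by apply: le_lt_trans ha1; rewrite mulr_ge0 ?sqrtr_ge0.
have ele1 : eps <= 1 by lra.
have e30 : 0 < eps ^+ 3 by apply: exprn_gt0.
have e31 : eps ^+ 3 <= 1 by rewrite exprn_ile1 ?(ltW e0).
(* The lower bound makes [M] large enough; the upper one keeps [N <= 2 / eps^3], as the bound on
   [lambda / d] demands. *)
have [N /andP[N1 N2]] : exists N : nat, (eps ^+ 3)^-1 <= N%:R <= (eps ^+ 3)^-1 + 1.
  by apply: nat_ceil; rewrite invr_ge0 ltW.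
have hN : 1 <= eps ^+ 3 * N%:R by rewrite -ler_pdivrMl // mulr1.
have N2' : N%:R <= 2 / eps ^+ 3.
  apply: le_trans N2 _; rewrite mulrC mulr_natr mulr2n lerD2l.
  by rewrite -[leLHS]invr1 lef_pV2 ?posrE.
have hl' : lambda <= eps ^+ (3 * N) * (d n)%:R.
  rewrite -ler_pdivrMr //; apply: le_trans hl _; exact: powR_ratio_le.
have [L hL] : exists L : nat, eps ^+ 2 * X / 100 <= L%:R <= eps ^+ 2 * X / 100 + 1.
  by apply: nat_ceil; rewrite divr_ge0 // mulr_ge0 ?exprn_ge0 ?(ltW e0) ?(ltW X0).
have main := percolation_no_cycle e0 e1 (leq_trans (isT : (0 < 3)%N) (d3 n)) nE hX ndl
  hN hl' hL x0.
rewrite random_subset_prob_complement lerD2l lerN2.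
have p01 : 0 <= (1 + eps) / (d n)%:R <= (1 : R).
  have : 3 <= (d n)%:R :> R by rewrite ler_nat.
  rewrite divr_ge0 ?(ltW D0) ?ler_pdivrMr //=; lra.
apply: (le_trans _ (le_trans main _)).
  apply: subset_mean_le => // S; rewrite ler_nat /no_cycle.
  case: asboolP => // nQ; case: asboolP => // hc; case: nQ.
  apply: has_cycle_ge_weaken hc; case/andP: hL => hL _; apply: le_trans hL.
  by rewrite (_ : _ / _ = eps ^+ 2 * X / 100) // /X; field; rewrite gt_eqF.
(* Since [alpha < eps^3 <= 1], one has [alpha^2 X <= X], which compares the two exponents. *)
rewrite ler_expR lerN2 -[alpha ^+ 2 * _ / _]mulrA -/X ler_wpM2l //.
  by rewrite divr_ge0 ?exprn_ge0 ?(ltW e0).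
rewrite ler_piMl ?(ltW X0) // exprn_ile1 ?(ltW a0) //.
exact: le_trans (ltW ha2) e31.
Unshelve. all: by end_near.
Qed.
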